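(* Let $I$ be an instance of HRLQ and let $\underline{q}_{\Sigma}=\sum_{h\in\mathcal H}\underline{q}(h)$ be the sum of the lower quotas of all hospitals. There is a polynomial-time algorithm that either outputs a feasible assignment for $I$ with at most $(\Delta_{\mathcal R}-1)\underline{q}_{\Sigma}$ blocking pairs, all of which involve residents from a set of at most $\underline{q}_{\Sigma}$ residents, or correctly concludes that no feasible assignment exists.
   Context: An instance of Hospitals/Residents with Lower Quotas (HRLQ) consists of a set $\mathcal R$ of residents and a set $\mathcal H$ of hospitals, each having a strict preference list over the acceptable members of the other set (acceptability is mutual), and for each hospital $h$ a lower quota $\underline{q}(h)$ and upper quota $\overline{q}(h)$. An assignment $M$ assigns a subset of residents to hospitals respecting acceptability, each resident to at most one hospital; $M(h)$ is the set of residents assigned to $h$. It is feasible if $\underline{q}(h)\le|M(h)|\le\overline{q}(h)$ for every $h$. A hospital is under-subscribed if $|M(h)|<\overline{q}(h)$. A pair $\{r,h\}$ of mutually acceptable resident and hospital is blocking if $r$ is unassigned or prefers $h$ to its assigned hospital, and $h$ is under-subscribed or prefers $r$ to some resident in $M(h)$. $\Delta_{\mathcal R}$ denotes the maximum length of a resident's preference list. *)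

(* Defs.v *)
From Corelib Require Import BinNums.
From HB Require Import structures.
From mathcomp Require Import all_boot all_order all_algebra.

Set Implicit Arguments.
Unset Strict Implicit.
Unset Printing Implicit Defensive.

(** * Hospitals/Residents with Lower Quotas *)

(* A strict preference list is a duplicate-free sequence, most preferred first;
   the acceptable agents are exactly those listed. *)
Record hrlq := HRLQ {
  nres : nat;
  nhosp : nat;
  rpref : 'I_nres -> seq 'I_nhosp;
  hpref : 'I_nhosp -> seq 'I_nres;
  lquota : 'I_nhosp -> nat;
  uquota : 'I_nhosp -> nat;
  rpref_uniq : forall r, uniq (rpref r);
  hpref_uniq : forall h, uniq (hpref h);
  mutual_acceptability : forall r h, (h \in rpref r) = (r \in hpref h)
}.

Definition resident (I : hrlq) : finType := 'I_(nres I).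
Definition hospital (I : hrlq) : finType := 'I_(nhosp I).

(* [prefers l x y]: x is strictly preferred to y; only used with x and y in l. *)
Definition prefers (T : eqType) (l : seq T) (x y : T) : bool :=
  index x l < index y l.

Section Assignments.
Variable I : hrlq.

(* [M r = None] means that r is unassigned. Acceptability is not part of the
   type; it is the predicate [is_assignment]. *)
Definition assignment := {ffun resident I -> option (hospital I)}.

Implicit Types (M : assignment) (r : resident I) (h : hospital I).

Definition is_assignment M : Prop :=
  forall r h, M r = Some h -> h \in rpref r.

Definition assigned_to M h : {set resident I} := [set r | M r == Some h].

Definition feasible M : Prop :=
  is_assignment M /\
  forall h, lquota h <= #|assigned_to M h| <= uquota h.

Definition under_subscribed M h : bool := #|assigned_to M h| < uquota h.

Definition blocking M r h : bool :=
  [&& h \in rpref r, r \in hpref h,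
      (if M r is Some h' then prefers (rpref r) h h' else true) &
      under_subscribed M h ||
        [exists r' in assigned_to M h, prefers (hpref h) r r']].

Definition blocking_pairs M : {set resident I * hospital I} :=
  [set rh | blocking M rh.1 rh.2].

Definition Delta_R : nat := \max_(r : resident I) size (rpref r).

Definition lquota_sum : nat := \sum_(h : hospital I) lquota h.

End Assignments.

(** * Polynomial time *)

(* The machine model is first-order Lisp: programs are finite lists of mutually
   recursive unary functions on binary trees, evaluated call-by-value, with unit
   cost per evaluation rule (cf. N. D. Jones, Computability and Complexity from
   a Programming Perspective). Values are passed as pointers, so every rule is a
   constant number of pointer operations, and this cost measure is polynomially
   related to Turing machine time. Equality of trees and arithmetic are not
   primitive. *)
Inductive tree := Leaf | Node of tree & tree.

Fixpoint tree_size (t : tree) : nat :=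
  if t is Node t1 t2 then (tree_size t1 + tree_size t2).+1 else 1.

(* Variables are de Bruijn indices. [ECase e e1 e2] runs e1 if e is [Leaf], and
   e2 with the left (index 0) and right (index 1) subtrees bound otherwise. *)
Inductive expr :=
| EVar of nat
| ELeaf
| ENode of expr & expr
| ECase of expr & expr & expr
| ELet of expr & expr
| ECall of nat & expr.

Definition program := seq expr.

Definition body (P : program) (f : nat) : expr := nth ELeaf P f.

(* [eval P env e v t]: e evaluates to v in environment env at cost t. *)
Inductive eval (P : program) : seq tree -> expr -> tree -> nat -> Prop :=
| eval_var env i : eval P env (EVar i) (nth Leaf env i) 1
| eval_leaf env : eval P env ELeaf Leaf 1
| eval_node env e1 e2 v1 v2 t1 t2 :
    eval P env e1 v1 t1 -> eval P env e2 v2 t2 ->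
    eval P env (ENode e1 e2) (Node v1 v2) (t1 + t2).+1
| eval_case_leaf env e e1 e2 v t t1 :
    eval P env e Leaf t -> eval P env e1 v t1 ->
    eval P env (ECase e e1 e2) v (t + t1).+1
| eval_case_node env e e1 e2 x y v t t2 :
    eval P env e (Node x y) t -> eval P [:: x, y & env] e2 v t2 ->
    eval P env (ECase e e1 e2) v (t + t2).+1
| eval_let env e1 e2 v1 v2 t1 t2 :
    eval P env e1 v1 t1 -> eval P (v1 :: env) e2 v2 t2 ->
    eval P env (ELet e1 e2) v2 (t1 + t2).+1
| eval_call env f e v1 v2 t1 t2 :
    eval P env e v1 t1 -> eval P [:: v1] (body P f) v2 t2 ->
    eval P env (ECall f e) v2 (t1 + t2).+1.

(* Function 0 is the entry point. *)
Definition run (P : program) (input output : tree) (time : nat) : Prop :=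
  eval P [:: input] (body P 0) output time.

Lemma eval_det P env e v t v' t' :
  eval P env e v t -> eval P env e v' t' -> v = v' /\ t = t'.
Proof.
move=> H; elim: H v' t' => {env e v t}
  [env i|env|env e1 e2 v1 v2 t1 t2 _ IH1 _ IH2|env e e1 e2 v t t1 _ IH1 _ IH2
  |env e e1 e2 x y v t t2 _ IH1 _ IH2|env e1 e2 v1 v2 t1 t2 _ IH1 _ IH2
  |env f e v1 v2 t1 t2 _ IH1 _ IH2] v' t' H; inversion H; subst => //.
all: repeat match goal with
  | IH : (forall v' t', eval _ ?env ?e v' t' -> _), K : eval _ ?env ?e _ _ |- _ =>
    case: {IH K} (IH _ _ K) => ? ?; subst
  | K : Node _ _ = Node _ _ |- _ => case: K => ? ?; subst
  | K : Leaf = Node _ _ |- _ => by []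
  | K : Node _ _ = Leaf |- _ => by []
  end; by [].
Qed.

(* There is one program that, on the encoding of every input a, halts within
   time polynomial in the size of that encoding and outputs the encoding of some
   b meeting the specification. *)
Definition polytime_solvable (A : Type) (B : A -> Type)
    (encA : A -> tree) (encB : forall a, B a -> tree)
    (spec : forall a, B a -> Prop) : Prop :=
  exists (P : program) (p : {poly nat}),
    forall a : A, exists (b : B a) (t : nat),
      [/\ run P (encA a) (encB a b) t, t <= (p.[tree_size (encA a)])%R
        & spec a b].

(** * Encodings *)

Definition enc_list : seq tree -> tree := foldr Node Leaf.

Definition enc_bit (b : bool) : tree := if b then Node Leaf Leaf else Leaf.

Fixpoint pos_bits (p : positive) : seq bool :=
  match p with
  | xH => [:: true]
  | xO p' => false :: pos_bits p'
  | xI p' => true :: pos_bits p'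
  end.

(* Numbers, in particular quotas, are in binary (least significant bit first,
   no leading zeros), so that a polynomial in the size of the encoding is not a
   polynomial in the value of the quotas. *)
Definition nat_bits (n : nat) : seq bool :=
  if bin_of_nat n is Npos p then pos_bits p else [::].

Definition enc_nat (n : nat) : tree := enc_list [seq enc_bit b | b <- nat_bits n].

Definition enc_option (T : Type) (enc : T -> tree) (o : option T) : tree :=
  if o is Some x then Node Leaf (enc x) else Leaf.

Definition enc_names (n : nat) (l : seq 'I_n) : tree :=
  enc_list [seq enc_nat i | i : 'I_n <- l].

Definition enc_resident (I : hrlq) (r : resident I) : tree :=
  Node (enc_nat r) (enc_names (rpref r)).

Definition enc_hospital (I : hrlq) (h : hospital I) : tree :=
  Node (enc_nat h)
    (Node (enc_nat (lquota h)) (Node (enc_nat (uquota h)) (enc_names (hpref h)))).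

Definition enc_instance (I : hrlq) : tree :=
  Node (enc_list [seq enc_resident r | r <- enum (resident I)])
       (enc_list [seq enc_hospital h | h <- enum (hospital I)]).

Definition enc_assignment (I : hrlq) (M : assignment I) : tree :=
  enc_list [seq enc_option (fun h : hospital I => enc_nat h) (M r)
           | r <- enum (resident I)].

(* [None] is the answer "no feasible assignment exists". *)
Definition enc_answer (I : hrlq) : option (assignment I) -> tree :=
  enc_option (@enc_assignment I).

Lemma enc_list_inj : injective enc_list.
Proof. by elim=> [|x s IH] [|y s'] //= [-> /IH ->]. Qed.

Lemma enc_nat_inj : injective enc_nat.
Proof.
move=> m n /enc_list_inj /inj_map H.
have /H {H} : injective enc_bit by do 2!case.
have pb_inj : injective pos_bits.
  have nnil p : pos_bits p <> [::] by case: p.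
  elim=> [p IH|p IH|] [q|q|] //= [].
  - by move/IH->.
  - by move/nnil.
  - by move/IH->.
  - by move/esym/nnil.
rewrite /nat_bits => E.
apply: (can_inj bin_of_natK); move: E.
case: (bin_of_nat m) (bin_of_nat n) => [|p] [|q] //.
- by case: q.
- by case: p.
- by move/pb_inj->.
Qed.

Lemma enc_answer_inj (I : hrlq) : injective (@enc_answer I).
Proof.
case=> [M|] [M'|] //= [] /enc_list_inj/eq_in_map E; congr Some.
apply/ffunP=> r; have := E r; rewrite mem_enum => /(_ isT).
by case: (M r) (M' r) => [h|] [h'|] //= [] /enc_nat_inj/val_inj->.
Qed.

(* Main.v *)
From Corelib Require Import BinNums.
Require Import Defs.
From HB Require Import structures.
From mathcomp Require Import all_boot all_order all_algebra.
From mathcomp Require Import zify.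

Set Implicit Arguments.
Unset Strict Implicit.
Unset Printing Implicit Defensive.

(** Split every hospital [h] into a low agent with [lquota h] places and an up
    agent with [uquota h - lquota h] places, and run deferred acceptance with
    the agents proposing. The up agent goes once through the list of [h], with
    offers of level 0. The low agent goes through that list [n + 1] times
    ([n] residents), with offers of levels [1, ..., n + 1]. A resident prefers
    offers of higher level and breaks ties by her own list.

    Levels behave like prices in an auction: if the low agent of [h] holds a
    resident at level [j], then all residents acceptable to [h] hold offers of
    level at least [j - 1], and if that agent is not full, of level [n + 1].
    Some level [v <= n] is the level of no resident, so in the latter case the
    residents above [v] violate Hall's condition for the lower quotas.

    Otherwise let [S] be the set of residents held by low agents. If [r] is not
    in [S], every low agent acceptable to [r] holds only residents at level 1
    that it prefers to [r], and [r] blocks with no up agent because the outcome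
    of deferred acceptance is stable. So all blocking pairs involve [S], and a
    resident of [S] never blocks with her own hospital. *)

(** * Closure properties of polynomial time *)

(** A program has to be exhibited, so its cost shapes every construction. Quotas are binary and may
    be exponentially large, hence hospitals are never expanded into unit places: a capacity only
    serves as a counter while a list is traversed. The number of levels depends on the number of
    residents alone, so offers are polynomially many and keys are small enough for unary.

    Prices rise evenly because an agent goes through its list level by level: before it holds
    anybody at level j > 1, each acceptable resident has been offered level j - 1, and she holds
    that offer or has dropped it for a larger key. A low agent with a free place has made all its
    offers of level n + 1, which exceeds every candidate for v. Hall's condition then fails above v:
    these residents are held by low agents of hospitals that accept only residents above v, and the
    hospital with the free place is of this kind too.

    Deferred acceptance is treated as deletion of offers. Its outcome is given by one predicate [Q]
    on offers, and correctness uses two facts: a deleted offer is beaten by an active one, and no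
    remaining offer is. *)

Fixpoint shift (k : nat) (e : expr) : expr :=
  match e with
  | EVar i => EVar i
  | ELeaf => ELeaf
  | ENode e1 e2 => ENode (shift k e1) (shift k e2)
  | ECase e0 e1 e2 => ECase (shift k e0) (shift k e1) (shift k e2)
  | ELet e1 e2 => ELet (shift k e1) (shift k e2)
  | ECall f e1 => ECall (k + f) (shift k e1)
  end.

Fixpoint calls_below (n : nat) (e : expr) : bool :=
  match e with
  | EVar _ | ELeaf => true
  | ENode e1 e2 | ELet e1 e2 => calls_below n e1 && calls_below n e2
  | ECase e0 e1 e2 =>
      [&& calls_below n e0, calls_below n e1 & calls_below n e2]
  | ECall f e1 => (f < n) && calls_below n e1
  end.

(** A call out of range runs the default body [ELeaf], and would run something else once functions
    are appended. Closedness excludes this, so that linking preserves evaluation. *)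
Definition closed_program (P : program) : bool := all (calls_below (size P)) P.

Lemma shift0 e : shift 0 e = e.
Proof. by elim: e => //= [? -> ? ->|? -> ? -> ? ->|? -> ? ->|? ? ->]. Qed.

Lemma calls_below_shift k n m e :
  k + n <= m -> calls_below n e -> calls_below m (shift k e).
Proof.
move=> le; elim: e => //= [? IH1 ? IH2|? IH1 ? IH2 ? IH3|? IH1 ? IH2|f e IH].
- by case/andP=> /IH1 -> /IH2 ->.
- by case/and3P=> /IH1 -> /IH2 -> /IH3 ->.
- by case/andP=> /IH1 -> /IH2 ->.
- by case/andP=> lt /IH ->; rewrite andbT (leq_trans _ le) // ltn_add2l.
Qed.

(** [Q] need only contain a renumbered copy of [P] at offset [k]. This covers both halves of a
    concatenation and, with [k = 1], the insertion of an entry point. *)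
Lemma eval_shift P Q k env e v t :
  closed_program P ->
  (forall f, f < size P -> body Q (k + f) = shift k (body P f)) ->
  eval P env e v t -> calls_below (size P) e -> eval Q env (shift k e) v t.
Proof.
move=> clP eqQ; elim=> {env e v t} /=; try by constructor.
- move=> env e1 e2 v1 v2 t1 t2 _ IH1 _ IH2 /andP[/IH1 ? /IH2 ?].
  by constructor.
- move=> env e e1 e2 v t t1 _ IH1 _ IH2 /and3P[/IH1 ? /IH2 ? _].
  exact: eval_case_leaf.
- move=> env e e1 e2 x y v t t2 _ IH1 _ IH2 /and3P[/IH1 ? _ /IH2 ?].
  by apply: eval_case_node; eassumption.
- move=> env e1 e2 v1 v2 t1 t2 _ IH1 _ IH2 /andP[/IH1 ? /IH2 ?].
  by apply: eval_let; eassumption.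
- move=> env f e v1 v2 t1 t2 _ IH1 _ IH2 /andP[ltf /IH1 ?].
  apply: eval_call; [eassumption | rewrite eqQ //; apply: IH2].
  exact: (all_nthP ELeaf clP).
Qed.

Lemma eval_catl P Q env e v t : closed_program P -> calls_below (size P) e ->
  eval P env e v t -> eval (P ++ Q) env e v t.
Proof.
move=> clP cle ev; rewrite -[e]shift0; apply: (eval_shift clP _ ev cle) => f ltf.
by rewrite shift0 /body nth_cat ltf.
Qed.

Lemma eval_catr P Q env e v t : closed_program Q -> calls_below (size Q) e ->
  eval Q env e v t ->
  eval (P ++ map (shift (size P)) Q) env (shift (size P) e) v t.
Proof.
move=> clQ cle ev; apply: (eval_shift clQ _ ev cle) => f ltf.
rewrite /body nth_cat ltnNge leq_addr /= addKn.
by rewrite (nth_map ELeaf).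
Qed.

Lemma closed_cat P Q : closed_program P -> closed_program Q ->
  closed_program (P ++ map (shift (size P)) Q).
Proof.
move=> clP clQ; rewrite /closed_program size_cat size_map all_cat all_map.
apply/andP; split.
  by apply: sub_all clP => e; rewrite -{2}[e]shift0; apply: calls_below_shift; lia.
by apply: sub_all clQ => e h; apply: calls_below_shift h.
Qed.

Lemma calls_below_le n m e : n <= m -> calls_below n e -> calls_below m e.
Proof. by move=> ? h; rewrite -[e]shift0; apply: calls_below_shift h; lia. Qed.

Definition lsub (t : tree) : tree := if t is Node x _ then x else Leaf.
Definition rsub (t : tree) : tree := if t is Node _ y then y else Leaf.

(** * Polynomial bounds and the judgement of polynomial-time computability *)

Section PolyBound.
Variables (A : Type) (D : A -> Prop) (sz : A -> nat).

(** The base is at least 2, so a larger exponent absorbs constants and sums, and a single power can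
    stand for any polynomial. *)
Definition pbound (f : A -> nat) : Prop :=
  exists c, forall a, D a -> f a <= (sz a).+2 ^ c.

Lemma pbound_le f g : (forall a, D a -> f a <= g a) -> pbound g -> pbound f.
Proof.
by move=> le [c gc]; exists c => a Da; apply: leq_trans (le a Da) (gc a Da).
Qed.

Lemma pbound_sz : pbound sz.
Proof. by exists 1 => a _; rewrite expn1 -addn2 leq_addr. Qed.

Lemma pbound_const n : pbound (fun=> n).
Proof.
exists n => a _; apply: leq_trans (ltnW (ltn_expl n (isT : 1 < 2))) _.
by case: n => // n; rewrite leq_exp2r.
Qed.

Lemma pbound_mul f g : pbound f -> pbound g -> pbound (fun a => f a * g a).
Proof.
move=> [c fc] [d gd]; exists (c + d) => a Da.
by rewrite expnD leq_mul ?fc ?gd.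
Qed.

Lemma pbound_add f g : pbound f -> pbound g -> pbound (fun a => f a + g a).
Proof.
move=> [c fc] [d gd]; exists (c + d).+1 => a Da.
have le1 k : 0 < (sz a).+2 ^ k by rewrite expn_gt0.
have := fc a Da; have := gd a Da; rewrite expnS expnD.
have := le1 c; have := le1 d; set x := _ ^ c; set y := _ ^ d; nia.
Qed.

End PolyBound.

(* [E a] is a typing context: the values of the variables, packed into the
   single argument of the program. [D] restricts the inputs and [sz] is the
   quantity in which running times are measured, so that all values computed
   from an instance are charged to the size of that instance. *)
Definition ptime (A : Type) (D : A -> Prop) (sz : A -> nat)
    (E : A -> seq tree) (F : A -> tree) : Prop :=
  exists (P : program) (e : expr),
    [/\ closed_program P, calls_below (size P) e
      & exists2 T, pbound D sz T & forall a, D a ->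
          exists2 t, eval P [:: enc_list (E a)] e (F a) t & t <= T a].

(** Each judgement brings its own program; a rule with two premises starts from this common function
    table. *)
Lemma link2 A1 A2 (D1 : A1 -> Prop) (D2 : A2 -> Prop) s1 s2 E1 E2 F1 F2 :
  ptime D1 s1 E1 F1 -> ptime D2 s2 E2 F2 ->
  exists (P : program) (e1 e2 : expr),
  [/\ closed_program P, calls_below (size P) e1, calls_below (size P) e2,
    exists2 T, pbound D1 s1 T & forall a, D1 a ->
          exists2 t, eval P [:: enc_list (E1 a)] e1 (F1 a) t & t <= T a
  & exists2 T, pbound D2 s2 T & forall a, D2 a ->
          exists2 t, eval P [:: enc_list (E2 a)] e2 (F2 a) t & t <= T a].
Proof.
move=> [P1 [e1 [cl1 cb1 [T1 b1 ev1]]]] [P2 [e2 [cl2 cb2 [T2 b2 ev2]]]].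
exists (P1 ++ map (shift (size P1)) P2), e1, (shift (size P1) e2); split.
- exact: closed_cat.
- by apply: calls_below_le cb1; rewrite size_cat leq_addr.
- by apply: calls_below_shift cb2; rewrite size_cat size_map.
- exists T1 => // a /ev1[t ev le]; exists t => //; exact: eval_catl.
- exists T2 => // a /ev2[t ev le]; exists t => //; exact: eval_catr.
Qed.

Lemma link3 A1 A2 A3 (D1 : A1 -> Prop) (D2 : A2 -> Prop) (D3 : A3 -> Prop)
    s1 s2 s3 E1 E2 E3 F1 F2 F3 :
  ptime D1 s1 E1 F1 -> ptime D2 s2 E2 F2 -> ptime D3 s3 E3 F3 ->
  exists (P : program) (e1 e2 e3 : expr),
  [/\ closed_program P,
      [/\ calls_below (size P) e1, calls_below (size P) e2
        & calls_below (size P) e3],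
    exists2 T, pbound D1 s1 T & forall a, D1 a ->
          exists2 t, eval P [:: enc_list (E1 a)] e1 (F1 a) t & t <= T a,
    exists2 T, pbound D2 s2 T & forall a, D2 a ->
          exists2 t, eval P [:: enc_list (E2 a)] e2 (F2 a) t & t <= T a
  & exists2 T, pbound D3 s3 T & forall a, D3 a ->
          exists2 t, eval P [:: enc_list (E3 a)] e3 (F3 a) t & t <= T a].
Proof.
move=> /link2 h1 /h1{h1} [P [e1 [e2 [cl cb1 cb2 [T1 b1 ev1] [T2 b2 ev2]]]]].
move=> [P3 [e3 [cl3 cb3 [T3 b3 ev3]]]].
exists (P ++ map (shift (size P)) P3), e1, e2, (shift (size P) e3); split.
- exact: closed_cat.
- split; last by apply: calls_below_shift cb3; rewrite size_cat size_map.
  + by apply: calls_below_le cb1; rewrite size_cat leq_addr.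
  + by apply: calls_below_le cb2; rewrite size_cat leq_addr.
- exists T1 => // a /ev1[t ev le]; exists t => //; exact: eval_catl.
- exists T2 => // a /ev2[t ev le]; exists t => //; exact: eval_catl.
- exists T3 => // a /ev3[t ev le]; exists t => //; exact: eval_catr.
Qed.

Lemma closed_extend P Q : closed_program P ->
  all (calls_below (size P + size Q)) Q -> closed_program (P ++ Q).
Proof.
move=> clP clQ; rewrite /closed_program size_cat all_cat clQ andbT.
by apply: sub_all clP => e; apply: calls_below_le; rewrite leq_addr.
Qed.

Lemma body_extend P Q i : i < size Q ->
  body (P ++ Q) (size P + i) = nth ELeaf Q i.
Proof. by move=> lt; rewrite /body nth_cat ltnNge leq_addr addKn. Qed.

(** * Rules for trees, contexts and case distinction *)

Section Rules.
Variables (A : Type) (D : A -> Prop) (sz : A -> nat).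
Implicit Types (E : A -> seq tree) (F : A -> tree).

Lemma pt_ext E F G : (forall a, D a -> F a = G a) ->
  ptime D sz E F -> ptime D sz E G.
Proof.
move=> eqFG [P [e [cl cb [T bT ev]]]]; exists P, e; split=> //; exists T => // a Da.
by rewrite -eqFG //; apply: ev.
Qed.

Lemma pt_leaf E : ptime D sz E (fun=> Leaf).
Proof.
exists [::], ELeaf; split=> //; exists (fun=> 1); first exact: pbound_const.
by move=> a _; exists 1 => //; constructor.
Qed.

Lemma pt_node E F G : ptime D sz E F -> ptime D sz E G ->
  ptime D sz E (fun a => Node (F a) (G a)).
Proof.
move=> /link2 h /h{h} [P [e1 [e2 [cl cb1 cb2 [T1 b1 ev1] [T2 b2 ev2]]]]].
exists P, (ENode e1 e2); split=> //=; first by rewrite cb1.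
exists (fun a => T1 a + T2 a + 1); first by do !apply: pbound_add => //; exact: pbound_const.
move=> a Da; have [t1 h1 le1] := ev1 a Da; have [t2 h2 le2] := ev2 a Da.
by exists (t1 + t2).+1; [constructor | lia].
Qed.

Lemma pt_lsub E F : ptime D sz E F -> ptime D sz E (fun a => lsub (F a)).
Proof.
move=> [P [e [cl cb [T b ev]]]].
exists P, (ECase e ELeaf (EVar 0)); split=> //=; first by rewrite cb.
exists (fun a => T a + 2); first by apply: pbound_add => //; exact: pbound_const.
move=> a Da; have [t h le] := ev a Da.
exists (t + 1).+1; last by lia.
case EF: (F a) h => [|x y] h /=.
  by apply: eval_case_leaf h _; constructor.
by apply: eval_case_node h _; apply: (eval_var _ [:: x, y & _] 0).
Qed.

Lemma pt_rsub E F : ptime D sz E F -> ptime D sz E (fun a => rsub (F a)).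
Proof.
move=> [P [e [cl cb [T b ev]]]].
exists P, (ECase e ELeaf (EVar 1)); split=> //=; first by rewrite cb.
exists (fun a => T a + 2); first by apply: pbound_add => //; exact: pbound_const.
move=> a Da; have [t h le] := ev a Da.
exists (t + 1).+1; last by lia.
case EF: (F a) h => [|x y] h /=.
  by apply: eval_case_leaf h _; constructor.
by apply: eval_case_node h _; apply: (eval_var _ [:: x, y & _] 1).
Qed.

Lemma pt_env E : ptime D sz E (fun a => enc_list (E a)).
Proof.
exists [::], (EVar 0); split=> //; exists (fun=> 1); first exact: pbound_const.
by move=> a _; exists 1 => //; apply: (eval_var _ [:: _] 0).
Qed.

Lemma pt_drop E i : ptime D sz E (fun a => enc_list (drop i (E a))).
Proof.
elim: i => [|i IH]; first by apply: pt_ext (pt_env E) => a _; rewrite drop0.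
apply: pt_ext (pt_rsub IH) => a _.
by rewrite -addn1 addnC -drop_drop; case: (drop i _) => //= x s; rewrite drop0.
Qed.

Lemma pt_var E i : ptime D sz E (fun a => nth Leaf (E a) i).
Proof.
apply: pt_ext (pt_lsub (pt_drop E i)) => a _.
by rewrite -[in RHS](addn0 i) -nth_drop; case: (drop i _).
Qed.

(** Functions are unary, so a change of context is a call of an appended function on the packed new
    context. Binding and weakening are instances. *)
Lemma pt_comp E E' F : ptime D sz E (fun a => enc_list (E' a)) ->
  ptime D sz E' F -> ptime D sz E F.
Proof.
move=> /link2 h /h{h} [P [e1 [e2 [cl cb1 cb2 [T1 b1 ev1] [T2 b2 ev2]]]]].
exists (P ++ [:: e2]), (ECall (size P) e1); split.
- by apply: closed_extend => //=; rewrite (calls_below_le _ cb2) ?leq_addr.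
- by rewrite size_cat /= addn1 ltnSn /= (calls_below_le _ cb1).
exists (fun a => T1 a + T2 a + 1); first by do !apply: pbound_add => //; exact: pbound_const.
move=> a Da; have [t1 h1 le1] := ev1 a Da; have [t2 h2 le2] := ev2 a Da.
exists (t1 + t2).+1; last by lia.
apply: eval_call; first exact: eval_catl h1.
rewrite -[size P]addn0 body_extend //=; exact: eval_catl h2.
Qed.

Lemma pt_let E F G : ptime D sz E F -> ptime D sz (fun a => F a :: E a) G ->
  ptime D sz E G.
Proof. by move=> hF; apply: pt_comp; apply: pt_node hF (pt_env E). Qed.

Lemma pt_weak E F x : ptime D sz E F -> ptime D sz (fun a => x a :: E a) F.
Proof. by apply: pt_comp; apply: pt_ext (pt_drop _ 1) => a _ /=; rewrite drop0. Qed.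

Lemma pt_weak2 E F x y : ptime D sz E F ->
  ptime D sz (fun a => [:: x a, y a & E a]) F.
Proof. by move=> h; do 2!apply: pt_weak. Qed.

(** [ECase] binds two variables, whereas the code of a branch expects its whole context in variable
    0. Each branch therefore becomes an appended function, called on a repacked context. *)
Lemma pt_case E C F : ptime D sz E C ->
  ptime (fun a => D a /\ C a = Leaf) sz E F ->
  ptime (fun a => D a /\ C a <> Leaf) sz
    (fun a => [:: lsub (C a), rsub (C a) & E a]) F ->
  ptime D sz E F.
Proof.
move=> /link3 h /h{h} h /h{h}.
move=> [P [e1 [e2 [e3 [cl [cb1 cb2 cb3] [T1 b1 ev1] [T2 b2 ev2] [T3 b3 ev3]]]]]].
exists (P ++ [:: e2; e3]), (ECase e1 (ECall (size P) (EVar 0))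
  (ECall (size P).+1 (ENode (EVar 0) (ENode (EVar 1) (EVar 2))))); split.
- apply: closed_extend => //=.
  by rewrite (calls_below_le _ cb2) ?(calls_below_le _ cb3) ?leq_addr.
- rewrite size_cat /= (calls_below_le _ cb1) ?leq_addr //=; lia.
(* [T2] and [T3] are bounded only where their branch is taken; the explicit powers give a bound on
   all of [D]. *)
case: b2 b3 => [c2 b2] [c3 b3].
exists (fun a => T1 a + ((sz a).+2 ^ c2 + (sz a).+2 ^ c3) + 10).
  do !apply: pbound_add => //; [by exists c2|by exists c3|exact: pbound_const].
move=> a Da; have [t1 h1 le1] := ev1 a Da.
case EC: (C a) h1 => [|x y] h1.
  have [t2 h2 le2] := ev2 a (conj Da EC).
  have := b2 a (conj Da EC) => b2a.
  exists (t1 + (1 + t2).+1).+1; last by lia.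
  apply: eval_case_leaf; first exact: eval_catl h1.
  apply: eval_call; first by apply: (eval_var _ [:: _] 0).
  by rewrite /= -[size P]addn0 body_extend //=; exact: eval_catl h2.
have nL : C a <> Leaf by rewrite EC.
have [t2 h2 le2] := ev3 a (conj Da nL).
have := b3 a (conj Da nL) => b3a.
exists (t1 + ((1 + (1 + 1).+1).+1 + t2).+1).+1; last by lia.
apply: eval_case_node; first exact: eval_catl h1.
apply: eval_call.
  by do !apply: eval_node; [apply: (eval_var _ [:: _; _; _] 0)
    |apply: (eval_var _ [:: _; _; _] 1)|apply: (eval_var _ [:: _; _; _] 2)].
rewrite -[(size P).+1]addn1 body_extend //=; move: h2; rewrite EC /=; exact: eval_catl.
Qed.

End Rules.

Lemma pt_pull (A B : Type) (p : B -> A) (D : A -> Prop) (D' : B -> Prop) sz sz' E F :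
  (forall b, D' b -> D (p b)) -> (forall b, D' b -> sz (p b) <= sz' b) ->
  ptime D sz E F -> ptime D' sz' (fun b => E (p b)) (fun b => F (p b)).
Proof.
move=> DD le [P [e [cl cb [T [c b] ev]]]]; exists P, e; split=> //.
exists (fun b => T (p b)); last by move=> x /DD /ev.
exists c => x Dx; apply: leq_trans (b _ (DD _ Dx)) _.
by case: (c) => // d; rewrite leq_exp2r // !ltnS le.
Qed.

(** The cost of a step is measured in the outer input and not in the accumulator, so iteration does
    not compound polynomials. Any bound on the accumulator that the step relies on must come from
    [Inv]. *)
Lemma pt_foldl (A : Type) (X : eqType) (S : Type) (D : A -> Prop) sz E
    (encX : X -> tree) (encS : S -> tree) (L : A -> seq X) (s0 : A -> S)
    (step : A -> S -> X -> S) (Inv : A -> S -> Prop) :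
  ptime D sz E (fun a => enc_list (map encX (L a))) ->
  ptime D sz E (fun a => encS (s0 a)) ->
  pbound D sz (fun a => size (L a)) ->
  (forall a, D a -> Inv a (s0 a)) ->
  (forall a s x, D a -> Inv a s -> x \in L a -> Inv a (step a s x)) ->
  ptime (fun b : A * X * S => [/\ D b.1.1, b.1.2 \in L b.1.1 & Inv b.1.1 b.2])
    (fun b => sz b.1.1)
    (fun b => [:: encX b.1.2, encS b.2 & E b.1.1])
    (fun b => encS (step b.1.1 b.2 b.1.2)) ->
  ptime D sz E (fun a => encS (foldl (step a) (s0 a) (L a))).
Proof.
move=> /link3 h /h{h} h bL Inv0 InvS /h{h}.
move=> [P [e1 [e2 [e3 [cl [cb1 cb2 cb3] [T1 b1 ev1] [T2 b2 ev2] [T3 [c b3] ev3]]]]]].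
set n := size P.
(* The argument is the remaining list, paired with the accumulator and the context. In the innermost
   branch variables 0 to 3 are accumulator, context, head and tail. *)
pose loop := ECase (EVar 0) ELeaf (ECase (EVar 0)
  (ECase (EVar 1) ELeaf (EVar 0))
  (ECase (EVar 3) ELeaf
    (ECall n.+1 (ENode (EVar 3)
       (ENode (ECall n (ENode (EVar 2) (ENode (EVar 0) (EVar 1)))) (EVar 1)))))).
pose Q := P ++ [:: e3; loop].
exists Q, (ECall n.+1 (ENode e1 (ENode e2 (EVar 0)))); split.
- apply: closed_extend => //=.
  rewrite (calls_below_le _ cb3) ?leq_addr //= /n; lia.
- rewrite /Q size_cat /= !(calls_below_le _ cb1, calls_below_le _ cb2) ?leq_addr //=.
  by rewrite /n; lia.
exists (fun a => T1 a + T2 a + ((size (L a) + 1) * ((sz a).+2 ^ c + 30) + 10)).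
  do !apply: pbound_add => //; last exact: pbound_const.
  apply: pbound_mul; first by apply: pbound_add => //; exact: pbound_const.
  by apply: pbound_add; [exists c | exact: pbound_const].
move=> a Da; have [t1 h1 le1] := ev1 a Da; have [t2 h2 le2] := ev2 a Da.
have bodyl : body Q n.+1 = loop by rewrite -[n.+1]addn1 body_extend.
have bodys : body Q n = e3 by rewrite -[n]addn0 body_extend.
have main l s : {subset l <= L a} -> Inv a s ->
  exists2 t, eval Q [:: Node (enc_list (map encX l)) (Node (encS s) (enc_list (E a)))]
     loop (encS (foldl (step a) s l)) t & t <= (size l + 1) * ((sz a).+2 ^ c + 30).
  elim: l s => [|x l IH] s sub Is /=.
    exists (1 + (1 + (1 + 1).+1).+1).+1; last by lia.
    apply: eval_case_node; first exact: (eval_var _ [:: _] 0).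
    apply: eval_case_leaf; first exact: (eval_var _ [:: _; _; _] 0).
    apply: eval_case_node; first exact: (eval_var _ [:: _; _; _] 1).
    exact: (eval_var _ [:: _, _ & _] 0).
  have xL : x \in L a by apply: sub; rewrite mem_head.
  have Dax : [/\ D (a, x, s).1.1, (a, x, s).1.2 \in L (a, x, s).1.1
    & Inv (a, x, s).1.1 (a, x, s).2] by [].
  have [t3 h3 le3] := ev3 _ Dax; have := b3 _ Dax => /= bt3.
  have [|t4 h4 le4] := IH (step a s x) _ (InvS _ _ _ Da Is xL).
    by move=> y yl; apply: sub; rewrite inE yl orbT.
  exists (1 + (1 + (1 + ((1 + (((1 + (1 + 1).+1).+1 + t3).+1 + 1).+1).+1 + t4).+1).+1).+1).+1;
    last by move: le3 bt3 le4; nia.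
  apply: eval_case_node; first exact: (eval_var _ [:: _] 0).
  apply: eval_case_node; first exact: (eval_var _ [:: _; _; _] 0).
  apply: eval_case_node; first exact: (eval_var _ [:: _; _; _; _; _] 3).
  apply: eval_call; last by rewrite bodyl; exact: h4.
  apply: eval_node; first exact: (eval_var _ [:: _, _, _, _ & _] 3).
  apply: eval_node; last exact: (eval_var _ [:: _, _ & _] 1).
  apply: eval_call; last by rewrite bodys; apply: eval_catl h3.
  apply: eval_node; first exact: (eval_var _ [:: _, _, _ & _] 2).
  by apply: eval_node; [exact: (eval_var _ [:: _, _ & _] 0)|
     exact: (eval_var _ [:: _, _ & _] 1)].
have [//|t h le] := main (L a) (s0 a) _ (Inv0 a Da).
exists ((t1 + (t2 + 1).+1).+1 + t).+1; last by lia.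
apply: eval_call; last by rewrite bodyl; exact: h.
apply: eval_node; first exact: eval_catl h1.
apply: eval_node; first exact: eval_catl h2.
exact: (eval_var _ [:: _] 0).
Qed.

Lemma pbound_pull (A B : Type) (p : B -> A) (D : A -> Prop) (D' : B -> Prop) sz f :
  (forall b, D' b -> D (p b)) -> pbound D sz f ->
  pbound D' (fun b => sz (p b)) (fun b => f (p b)).
Proof. by move=> DD [c b]; exists c => x /DD /b. Qed.

Lemma pt_dom (A : Type) (D D' : A -> Prop) sz E F :
  (forall a, D' a -> D a) -> ptime D sz E F -> ptime D' sz E F.
Proof. by move=> h; apply: (pt_pull (p := id)). Qed.

(** * Booleans *)

Definition is_node (t : tree) : bool := if t is Node _ _ then true else false.

Section BoolRules.
Variables (A : Type) (D : A -> Prop) (sz : A -> nat) (E : A -> seq tree).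

Lemma pt_true : ptime D sz E (fun=> enc_bit true).
Proof. exact: pt_node (pt_leaf _ _ _) (pt_leaf _ _ _). Qed.

Lemma pt_false : ptime D sz E (fun=> enc_bit false).
Proof. exact: pt_leaf. Qed.

Lemma pt_if (b : A -> bool) F G :
  ptime D sz E (fun a => enc_bit (b a)) ->
  ptime (fun a => D a /\ b a) sz E F -> ptime (fun a => D a /\ ~~ b a) sz E G ->
  ptime D sz E (fun a => if b a then F a else G a).
Proof.
move=> hb hF hG; apply: (pt_case hb).
  apply: pt_ext (pt_dom _ hG) => a [Da]; first by case: (b a).
  by case: (b a) => // _; split.
apply: pt_weak2; apply: pt_ext (pt_dom _ hF) => a [Da]; first by case: (b a).
by case: (b a) => // _; split.
Qed.

Lemma pt_ifT (b : A -> bool) F G :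
  ptime D sz E (fun a => enc_bit (b a)) -> ptime D sz E F -> ptime D sz E G ->
  ptime D sz E (fun a => if b a then F a else G a).
Proof. by move=> hb hF hG; apply: pt_if => //; [apply: pt_dom hF|apply: pt_dom hG] => a []. Qed.

Lemma pt_is_node F : ptime D sz E F -> ptime D sz E (fun a => enc_bit (is_node (F a))).
Proof.
move=> hF; apply: (pt_case hF).
  by apply: pt_ext (pt_leaf _ _ _) => a [_ ->].
apply: pt_ext (pt_node (pt_leaf _ _ _) (pt_leaf _ _ _)) => a [_].
by case: (F a).
Qed.

Lemma pt_negb (b : A -> bool) : ptime D sz E (fun a => enc_bit (b a)) ->
  ptime D sz E (fun a => enc_bit (~~ b a)).
Proof.
move=> hb; apply: pt_ext (pt_ifT hb pt_false pt_true) => a _.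
by case: (b a).
Qed.

Lemma pt_andb (b c : A -> bool) :
  ptime D sz E (fun a => enc_bit (b a)) -> ptime D sz E (fun a => enc_bit (c a)) ->
  ptime D sz E (fun a => enc_bit (b a && c a)).
Proof.
move=> hb hc; apply: pt_ext (pt_ifT hb hc pt_false) => a _.
by case: (b a).
Qed.

Lemma pt_orb (b c : A -> bool) :
  ptime D sz E (fun a => enc_bit (b a)) -> ptime D sz E (fun a => enc_bit (c a)) ->
  ptime D sz E (fun a => enc_bit (b a || c a)).
Proof.
move=> hb hc; apply: pt_ext (pt_ifT hb pt_true hc) => a _.
by case: (b a).
Qed.

Lemma pt_skip x y F : ptime D sz (fun a => x a :: E a) F ->
  ptime D sz (fun a => [:: x a, y a & E a]) F.
Proof.
apply: pt_comp; apply: pt_node (pt_var _ _ _ 0) _.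
by apply: pt_ext (pt_drop _ _ _ 2) => a _ /=; rewrite drop0.
Qed.

End BoolRules.

(** * Lists *)

Definition elist (X : Type) (encX : X -> tree) (l : seq X) : tree :=
  enc_list (map encX l).

Section ListRules.
Variables (A : Type) (D : A -> Prop) (sz : A -> nat) (E : A -> seq tree).
Variables (X : eqType) (encX : X -> tree).
Implicit Types (L : A -> seq X).

Definition ranging L (b : A * X) : Prop := D b.1 /\ b.2 \in L b.1.

Lemma pt_rev L : ptime D sz E (fun a => elist encX (L a)) ->
  pbound D sz (fun a => size (L a)) ->
  ptime D sz E (fun a => elist encX (rev (L a))).
Proof.
move=> hL bL.
apply: (@pt_ext _ _ _ _ (fun a => elist encX (foldl (fun s x => x :: s) [::] (L a)))).
  move=> a _; congr elist; rewrite -[in LHS](revK (L a)) foldl_rev.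
  by elim: (rev _) => //= x s ->.
apply: (@pt_foldl _ _ _ _ _ _ encX _ _ (fun=> [::]) (fun _ s x => x :: s) (fun _ _ => True)) => //.
  exact: pt_leaf.
exact: pt_node (pt_var _ _ _ 0) (pt_var _ _ _ 1).
Qed.

Lemma pt_foldr (S : Type) (encS : S -> tree) L (s0 : A -> S)
    (step : A -> X -> S -> S) (Inv : A -> S -> Prop) :
  ptime D sz E (fun a => elist encX (L a)) ->
  ptime D sz E (fun a => encS (s0 a)) ->
  pbound D sz (fun a => size (L a)) ->
  (forall a, D a -> Inv a (s0 a)) ->
  (forall a s x, D a -> Inv a s -> x \in L a -> Inv a (step a x s)) ->
  ptime (fun b : A * X * S => [/\ D b.1.1, b.1.2 \in L b.1.1 & Inv b.1.1 b.2])
    (fun b => sz b.1.1)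
    (fun b => [:: encX b.1.2, encS b.2 & E b.1.1])
    (fun b => encS (step b.1.1 b.1.2 b.2)) ->
  ptime D sz E (fun a => encS (foldr (step a) (s0 a) (L a))).
Proof.
move=> hL hs bL I0 IS hstep.
have := @pt_foldl A X S D sz E encX encS (fun a => rev (L a)) s0
  (fun a s x => step a x s) Inv (pt_rev hL bL) hs.
move=> h; apply: pt_ext (h _ I0 _ _) => [a _||a s x Da Is|].
- by rewrite foldl_rev.
- by case: bL => c b; exists c => a /b; rewrite size_rev.
- by rewrite mem_rev; apply: IS.
- by apply: pt_dom hstep => b; rewrite mem_rev.
Qed.

Lemma pt_map (Y : Type) (encY : Y -> tree) L (f : A -> X -> Y) :
  ptime D sz E (fun a => elist encX (L a)) -> pbound D sz (fun a => size (L a)) ->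
  ptime (ranging L) (fun b => sz b.1) (fun b => encX b.2 :: E b.1)
    (fun b => encY (f b.1 b.2)) ->
  ptime D sz E (fun a => elist encY (map (f a) (L a))).
Proof.
move=> hL bL hf.
apply: (@pt_ext _ _ _ _ (fun a => elist encY (foldr (fun x s => f a x :: s) [::] (L a)))).
  by move=> a _; congr elist; elim: (L a) => //= x s ->.
apply: (@pt_foldr (seq Y) _ _ (fun=> [::]) (fun a x s => f a x :: s) (fun _ _ => True)) => //.
  exact: pt_leaf.
apply: pt_node; last exact: (pt_var _ _ _ 1).
by apply: pt_skip; apply: (pt_pull (p := fun b => (b.1.1, b.1.2))) hf => // b [].
Qed.

Lemma pt_filter L (p : A -> pred X) :
  ptime D sz E (fun a => elist encX (L a)) -> pbound D sz (fun a => size (L a)) ->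
  ptime (ranging L) (fun b => sz b.1) (fun b => encX b.2 :: E b.1)
    (fun b => enc_bit (p b.1 b.2)) ->
  ptime D sz E (fun a => elist encX (filter (p a) (L a))).
Proof.
move=> hL bL hf.
apply: (@pt_ext _ _ _ _ (fun a => elist encX
    (foldr (fun x s => if p a x then x :: s else s) [::] (L a)))) => //.
apply: (@pt_foldr (seq X) _ _ (fun=> [::])
  (fun a x s => if p a x then x :: s else s) (fun _ _ => True)) => //.
  exact: pt_leaf.
apply: (@pt_ext _ _ _ _ (fun b => if p b.1.1 b.1.2 then
    Node (encX b.1.2) (elist encX b.2) else elist encX b.2)).
  by move=> b _; case: (p _ _).
apply: pt_ifT; last exact: (pt_var _ _ _ 1).
  by apply: pt_skip; apply: (pt_pull (p := fun b => (b.1.1, b.1.2))) hf => // b [].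
exact: pt_node (pt_var _ _ _ 0) (pt_var _ _ _ 1).
Qed.

Lemma pt_has L (p : A -> pred X) :
  ptime D sz E (fun a => elist encX (L a)) -> pbound D sz (fun a => size (L a)) ->
  ptime (ranging L) (fun b => sz b.1) (fun b => encX b.2 :: E b.1)
    (fun b => enc_bit (p b.1 b.2)) ->
  ptime D sz E (fun a => enc_bit (has (p a) (L a))).
Proof.
move=> hL bL hf.
apply: (@pt_foldr bool _ _ (fun=> false) (fun a x s => p a x || s) (fun _ _ => True)) => //.
  exact: pt_leaf.
apply: pt_orb.
  by apply: pt_skip; apply: (pt_pull (p := fun b => (b.1.1, b.1.2))) hf => // b [].
exact: (pt_var _ _ _ 1).
Qed.

Lemma pt_all L (p : A -> pred X) :
  ptime D sz E (fun a => elist encX (L a)) -> pbound D sz (fun a => size (L a)) ->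
  ptime (ranging L) (fun b => sz b.1) (fun b => encX b.2 :: E b.1)
    (fun b => enc_bit (p b.1 b.2)) ->
  ptime D sz E (fun a => enc_bit (all (p a) (L a))).
Proof.
move=> hL bL hf.
apply: (@pt_foldr bool _ _ (fun=> true) (fun a x s => p a x && s) (fun _ _ => True)) => //.
  exact: pt_true.
apply: pt_andb.
  by apply: pt_skip; apply: (pt_pull (p := fun b => (b.1.1, b.1.2))) hf => // b [].
exact: (pt_var _ _ _ 1).
Qed.

Lemma pt_cat L1 L2 :
  ptime D sz E (fun a => elist encX (L1 a)) ->
  ptime D sz E (fun a => elist encX (L2 a)) -> pbound D sz (fun a => size (L1 a)) ->
  ptime D sz E (fun a => elist encX (L1 a ++ L2 a)).
Proof.
move=> h1 h2 b1.
apply: (@pt_ext _ _ _ _ (fun a => elist encX (foldr cons (L2 a) (L1 a)))).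
  by move=> a _; congr elist; elim: (L1 a) => //= x s ->.
apply: (@pt_foldr (seq X) _ _ _ (fun _ x s => x :: s) (fun _ _ => True)) => //.
exact: pt_node (pt_var _ _ _ 0) (pt_var _ _ _ 1).
Qed.

End ListRules.

Lemma pt_flatten (A : Type) (D : A -> Prop) sz E (X : eqType) (encX : X -> tree)
    (LL : A -> seq (seq X)) :
  ptime D sz E (fun a => elist (elist encX) (LL a)) ->
  pbound D sz (fun a => size (LL a)) ->
  pbound (ranging D LL) (fun b => sz b.1) (fun b => size b.2) ->
  ptime D sz E (fun a => elist encX (flatten (LL a))).
Proof.
move=> hL bL bx.
apply: (@pt_foldr _ _ _ _ _ _ _ _ _ (fun=> [::]) (fun _ x s => x ++ s)
  (fun _ _ => True)) => //; try eassumption; first exact: pt_leaf.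
apply: pt_cat; [exact: (pt_var _ _ _ 0)|exact: (pt_var _ _ _ 1)|].
by apply: (pbound_pull (p := fun b => (b.1.1, b.1.2))) bx => b [].
Qed.

(** * Unary numbers *)

Definition un (k : nat) : tree := enc_list (nseq k Leaf).

Lemma un_elist k : un k = elist (fun=> Leaf) (nseq k tt).
Proof. by rewrite /un /elist map_nseq. Qed.

Lemma is_node_un k : is_node (un k) = (0 < k). Proof. by case: k. Qed.

Section UnaryRules.
Variables (A : Type) (D : A -> Prop) (sz : A -> nat) (E : A -> seq tree).
Implicit Types (m n : A -> nat).

Lemma pt_size (X : eqType) (encX : X -> tree) (L : A -> seq X) :
  ptime D sz E (fun a => elist encX (L a)) -> pbound D sz (fun a => size (L a)) ->
  ptime D sz E (fun a => un (size (L a))).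
Proof.
move=> hL bL; apply: (@pt_foldr _ _ _ _ _ _ _ _ _ (fun=> 0) (fun _ _ s => s.+1)
  (fun _ _ => True)) => //; try eassumption; first exact: pt_leaf.
exact: pt_node (pt_leaf _ _ _) (pt_var _ _ _ 1).
Qed.

Lemma foldr_nseq_iter T (f : T -> T) k x :
  foldr (fun (_ : unit) s => f s) x (nseq k tt) = iter k f x.
Proof. by elim: k => //= k ->. Qed.

Lemma pt_un_iter (S : Type) (encS : S -> tree) n (s0 : A -> S) (f : A -> S -> S) Inv :
  ptime D sz E (fun a => un (n a)) -> pbound D sz n ->
  ptime D sz E (fun a => encS (s0 a)) ->
  (forall a, D a -> Inv a (s0 a)) ->
  (forall a s, D a -> Inv a s -> Inv a (f a s)) ->
  ptime (fun b : A * S => D b.1 /\ Inv b.1 b.2) (fun b => sz b.1)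
    (fun b => encS b.2 :: E b.1) (fun b => encS (f b.1 b.2)) ->
  ptime D sz E (fun a => encS (iter (n a) (f a) (s0 a))).
Proof.
move=> hn bn hs I0 IS hf.
apply: (@pt_ext _ _ _ _ (fun a => encS (foldr (fun (_ : unit) s => f a s) (s0 a) (nseq (n a) tt)))).
  by move=> a _; rewrite foldr_nseq_iter.
apply: (@pt_foldr _ _ _ _ _ (fun=> Leaf) _ _ _ _ (fun a _ s => f a s) Inv) => //.
- by apply: pt_ext hn => a _; rewrite un_elist.
- by case: bn => c b; exists c => a /b; rewrite size_nseq.
- by move=> a s x Da Is _; apply: IS.
- apply: pt_weak; apply: (pt_pull (p := fun b => (b.1.1, b.2))) hf => // b [] //.
Qed.

Lemma pt_un_add m n : ptime D sz E (fun a => un (m a)) -> ptime D sz E (fun a => un (n a)) ->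
  pbound D sz m -> ptime D sz E (fun a => un (m a + n a)).
Proof.
move=> hm hn bm; apply: (@pt_ext _ _ _ _ (fun a => un (iter (m a) succn (n a)))).
  by move=> a _; rewrite iter_succn addnC.
apply: (@pt_un_iter _ _ _ _ (fun=> succn) (fun _ _ => True)) => //.
exact: pt_node (pt_leaf _ _ _) (pt_var _ _ _ 0).
Qed.

Lemma pt_un_sub m n : ptime D sz E (fun a => un (m a)) -> ptime D sz E (fun a => un (n a)) ->
  pbound D sz n -> ptime D sz E (fun a => un (m a - n a)).
Proof.
move=> hm hn bn; apply: (@pt_ext _ _ _ _ (fun a => un (iter (n a) predn (m a)))).
  by move=> a _; rewrite iter_predn.
apply: (@pt_un_iter _ _ _ _ (fun=> predn) (fun _ _ => True)) => //.
by apply: pt_ext (pt_rsub (pt_var _ _ _ 0)) => -[a [|k]].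
Qed.

Lemma pt_un_lt m n : ptime D sz E (fun a => un (m a)) -> ptime D sz E (fun a => un (n a)) ->
  pbound D sz m -> ptime D sz E (fun a => enc_bit (m a < n a)).
Proof.
move=> hm hn bm; apply: pt_ext (pt_is_node (pt_un_sub hn hm bm)) => a _.
by rewrite is_node_un subn_gt0.
Qed.

End UnaryRules.

Lemma pt_un_mul (A : Type) (D : A -> Prop) sz E (m n : A -> nat) :
  ptime D sz E (fun a => un (m a)) -> ptime D sz E (fun a => un (n a)) ->
  pbound D sz m -> pbound D sz n -> ptime D sz E (fun a => un (m a * n a)).
Proof.
move=> hm hn bm bn; apply: (@pt_ext _ _ _ _ (fun a => un (iter (m a) (addn (n a)) 0))).
  by move=> a _; rewrite iter_addn_0 mulnC.
apply: (@pt_un_iter _ _ _ _ _ _ _ _ (fun a => addn (n a)) (fun _ _ => True)) => //.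
  exact: pt_leaf.
apply: pt_un_add; last by apply: pbound_pull bn => b [].
  by apply: pt_weak; apply: pt_pull hn => // b [].
exact: (pt_var _ _ _ 0).
Qed.

(** * Binary numbers *)

Definition eq_bits_step (st : option (seq bool)) (b : bool) : option (seq bool) :=
  if st is Some (b' :: r) then if b == b' then Some r else None else None.

(** The fold consumes [l'] along [l]. A mismatch or a missing bit is recorded for good by [None],
    and surplus bits of [l'] remain in the state. *)
Lemma eq_bits_foldl l l' : (foldl eq_bits_step (Some l') l == Some [::]) = (l == l').
Proof.
have none s : foldl eq_bits_step None s = None by elim: s.
elim: l l' => [|b l IH] [|b' l'] //=; first by rewrite none.
by rewrite eqseq_cons; case: (b == b'); rewrite /= ?IH ?none.
Qed.

(* Predecessor of a little-endian numeral; the first component of the folded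
   state is the suffix already traversed. *)
Definition pred_bits_step (b : bool) (s : seq bool * seq bool) :=
  (b :: s.1, if b then (if s.1 is [::] then [::] else false :: s.1) else true :: s.2).

Definition pred_bits (l : seq bool) : seq bool := (foldr pred_bits_step ([::], [::]) l).2.

(** A lone top bit disappears instead of turning into a zero, because numerals have no leading
    zeros. *)
Lemma pred_bits_cons b l : pred_bits (b :: l) =
  if b then (if l is [::] then [::] else false :: l) else true :: pred_bits l.
Proof.
have fst1 s : (foldr pred_bits_step ([::], [::]) s).1 = s by elim: s => //= ? ? ->.
by rewrite /pred_bits /= fst1.
Qed.

Lemma nat_bitsK N : nat_bits (nat_of_bin N) =
  if N is Npos p then pos_bits p else [::].
Proof. by rewrite /nat_bits nat_of_binK. Qed.

Lemma nat_bits_pred n : nat_bits n.-1 = pred_bits (nat_bits n).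
Proof.
rewrite -{1}(bin_of_natK n) [in RHS]/nat_bits; case: (bin_of_nat n) => //= p.
have pbnil q : pos_bits q <> [::] by case: q.
elim: p => [p IH|p IH|] //.
  have -> : (nat_of_pos (xI p)).-1 = nat_of_bin (Npos (xO p)) by [].
  by rewrite nat_bitsK /= pred_bits_cons; case: (pos_bits p) (pbnil p).
(* For an even number, 2p - 1 = 2(p - 1) + 1. The case [p = 1] is separate, since p - 1 is then not
   a [positive]. *)
rewrite /= pred_bits_cons -IH; case E : (nat_of_pos p).-1 => [|k].
  have -> : (nat_of_pos p) = 1.
    have : nat_of_pos p != 0 by apply/eqP => p0; move: (nat_of_binK (Npos p)); rewrite /= p0.
    by move: E; case: (nat_of_pos p) => // -[].
  by [].
have E2 : nat_of_pos p = k.+2 by move: E; case: (nat_of_pos p) => //= ? ->.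
have := nat_bitsK (bin_of_nat k.+1); rewrite bin_of_natK => ->.
move: (bin_of_natK k.+1); case: (bin_of_nat k.+1) => // q /= Eq.
have -> : (NatTrec.double (nat_of_pos p)).-1 = nat_of_bin (Npos (xI q)).
  by rewrite /= !NatTrec.doubleE Eq E2 !doubleS.
by rewrite nat_bitsK.
Qed.

Lemma size_nat_bits_pred n : size (nat_bits n.-1) <= size (nat_bits n).
Proof.
rewrite nat_bits_pred; elim: (nat_bits n) => // b l IH; rewrite pred_bits_cons.
by case: b; case: l IH.
Qed.

Lemma nat_bits_inj : injective nat_bits.
Proof. by move=> m n E; apply: enc_nat_inj; rewrite /enc_nat E. Qed.

Lemma is_node_enc_nat n : is_node (enc_nat n) = (n != 0).
Proof.
rewrite /enc_nat; apply/idP/idP => [|n0]; first by case: n.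
case E: (nat_bits n) => [|//]; case/eqP: n0.
by apply: nat_bits_inj; rewrite E.
Qed.

Section BinaryRules.
Variables (A : Type) (D : A -> Prop) (sz : A -> nat) (E : A -> seq tree).
Implicit Types (m n : A -> nat).

Definition nbits n : A -> nat := fun a => size (nat_bits (n a)).

Lemma pt_eqn m n : ptime D sz E (fun a => enc_nat (m a)) ->
  ptime D sz E (fun a => enc_nat (n a)) -> pbound D sz (nbits m) ->
  ptime D sz E (fun a => enc_bit (m a == n a)).
Proof.
move=> hm hn bm.
pose res a := foldl eq_bits_step (Some (nat_bits (n a))) (nat_bits (m a)).
have hres : ptime D sz E (fun a => enc_option (elist enc_bit) (res a)).
  apply: (@pt_foldl _ _ _ _ _ _ enc_bit (enc_option (elist enc_bit)) _
    (fun a => Some (nat_bits (n a))) (fun _ => eq_bits_step) (fun _ _ => True)) => //.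
    exact: pt_node (pt_leaf _ _ _) hn.
  apply: (pt_case (pt_rsub (pt_var _ _ _ 1))).
    apply: pt_ext (pt_leaf _ _ _) => -[[a b] [[|b' s]|]] //= [_] //.
  apply: (@pt_ext _ _ _ _ (fun b => if b.1.2 == is_node (lsub (rsub
      (enc_option (elist enc_bit) b.2))) then Node Leaf (rsub (rsub
      (enc_option (elist enc_bit) b.2))) else Leaf)).
    move=> [[a b] [[|b' s]|]] //= [_] //; first by case: b; case: b'.
  apply: pt_ifT; last exact: pt_leaf.
    apply: (@pt_ext _ _ _ _ (fun b => enc_bit (if b.1.2 then is_node (lsub (rsub
      (enc_option (elist enc_bit) b.2))) else ~~ is_node (lsub (rsub
      (enc_option (elist enc_bit) b.2)))))).
      by move=> [[a []] s] _ /=; case: is_node.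
    apply: (@pt_ext _ _ _ _ (fun b => if b.1.2 then enc_bit (is_node (lsub (rsub
      (enc_option (elist enc_bit) b.2)))) else enc_bit (~~ is_node (lsub (rsub
      (enc_option (elist enc_bit) b.2)))))).
      by move=> [[a []] s].
    apply: pt_ifT; first exact: (pt_var _ _ _ 2).
      by apply: pt_is_node; exact: (pt_var _ _ _ 0).
    by apply: pt_negb; apply: pt_is_node; exact: (pt_var _ _ _ 0).
  by apply: pt_node; [exact: pt_leaf|exact: (pt_var _ _ _ 1)].
apply: pt_ext (pt_andb (pt_is_node hres) (pt_negb (pt_is_node (pt_rsub hres)))) => a _.
rewrite -(inj_eq nat_bits_inj) -eq_bits_foldl -/(res a).
by case: (res a) => [[|? ?]|].
Qed.

Lemma pt_pred n : ptime D sz E (fun a => enc_nat (n a)) -> pbound D sz (nbits n) ->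
  ptime D sz E (fun a => enc_nat (n a).-1).
Proof.
move=> hn bn.
pose encS (s : seq bool * seq bool) := Node (elist enc_bit s.1) (elist enc_bit s.2).
have h : ptime D sz E (fun a => encS (foldr pred_bits_step ([::], [::]) (nat_bits (n a)))).
  apply: (@pt_foldr _ _ _ _ _ enc_bit _ encS _ (fun=> ([::], [::]))
    (fun _ => pred_bits_step) (fun _ _ => True)) => //.
    exact: pt_node (pt_leaf _ _ _) (pt_leaf _ _ _).
  apply: pt_node.
    exact: pt_node (pt_var _ _ _ 0) (pt_lsub (pt_var _ _ _ 1)).
  apply: (@pt_ext _ _ _ _ (fun b => if b.1.2 then (if is_node (lsub (encS b.2))
      then Node Leaf (lsub (encS b.2)) else Leaf)
      else Node (enc_bit true) (rsub (encS b.2)))).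
    by move=> [[a []] [[|? ?] s]].
  apply: pt_ifT; first exact: (pt_var _ _ _ 0).
    apply: pt_ifT; last exact: pt_leaf.
      exact: pt_is_node (pt_lsub (pt_var _ _ _ 1)).
    exact: pt_node (pt_leaf _ _ _) (pt_lsub (pt_var _ _ _ 1)).
  exact: pt_node (pt_true _ _ _) (pt_rsub (pt_var _ _ _ 1)).
apply: pt_ext (pt_rsub h) => a _.
by rewrite /enc_nat nat_bits_pred.
Qed.

Lemma pt_neq0 n : ptime D sz E (fun a => enc_nat (n a)) ->
  ptime D sz E (fun a => enc_bit (n a != 0)).
Proof. by move=> hn; apply: pt_ext (pt_is_node hn) => a _; rewrite is_node_enc_nat. Qed.

End BinaryRules.

(** * Truncation of a list at a binary length *)

Definition take_step (X : Type) (s : nat * seq X) (x : X) : nat * seq X :=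
  if s.1 != 0 then (s.1.-1, x :: s.2) else s.

(** One pass with a binary counter yields both the truncated list, reversed, and the unmet demand
    [n - size l]. A unary copy of [n] could be exponentially long. *)
Lemma foldl_take_step X n (acc l : seq X) :
  foldl (@take_step X) (n, acc) l = (n - size l, rev (take n l) ++ acc).
Proof.
elim: l n acc => [|x l IH] n acc /=; first by rewrite subn0.
case: n => [|n] /=; first by rewrite /take_step /= IH sub0n take0.
by rewrite /take_step /= IH subSS rev_cons cat_rcons.
Qed.

Section TakeRules.
Variables (A : Type) (D : A -> Prop) (sz : A -> nat) (E : A -> seq tree).
Variables (X : eqType) (encX : X -> tree) (n : A -> nat) (L : A -> seq X).
Hypotheses (hn : ptime D sz E (fun a => enc_nat (n a))) (bn : pbound D sz (nbits n)).
Hypotheses (hL : ptime D sz E (fun a => elist encX (L a))).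
Hypothesis bL : pbound D sz (fun a => size (L a)).

Lemma pt_take_aux : ptime D sz E
  (fun a => Node (enc_nat (n a - size (L a))) (elist encX (rev (take (n a) (L a))))).
Proof.
pose encS (s : nat * seq X) := Node (enc_nat s.1) (elist encX s.2).
apply: (@pt_ext _ _ _ _ (fun a => encS (foldl (@take_step X) (n a, [::]) (L a)))).
  by move=> a _; rewrite foldl_take_step cats0.
(* The predecessor never has a longer numeral, so the counter stays within the bit length of [n]. *)
apply: (@pt_foldl _ _ _ _ _ _ encX encS _ (fun a => (n a, [::])) (fun _ => @take_step X)
  (fun a s => size (nat_bits s.1) <= size (nat_bits (n a)))) => //.
- exact: pt_node hn (pt_leaf _ _ _).
- move=> a s x _ h _; rewrite /take_step; case: ifP => // _.
  exact: leq_trans (size_nat_bits_pred _) h.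
apply: (@pt_ext _ _ _ _ (fun b => if b.2.1 != 0 then
  Node (enc_nat b.2.1.-1) (Node (encX b.1.2) (elist encX b.2.2)) else encS b.2)).
  by move=> b _; rewrite /take_step; case: ifP.
have hn1 : ptime (fun b : A * X * (nat * seq X) => [/\ D b.1.1, b.1.2 \in L b.1.1
     & size (nat_bits b.2.1) <= size (nat_bits (n b.1.1))]) (fun b => sz b.1.1)
  (fun b => [:: encX b.1.2, encS b.2 & E b.1.1]) (fun b => enc_nat b.2.1).
  exact: (pt_lsub (pt_var _ _ _ 1)).
apply: pt_ifT; last exact: (pt_var _ _ _ 1).
  exact: pt_neq0.
apply: pt_node; last by apply: pt_node (pt_var _ _ _ 0) (pt_rsub (pt_var _ _ _ 1)).
apply: pt_pred => //.
apply: (@pbound_le _ _ _ _ (fun b => nbits n b.1.1)); first by move=> b [].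
by apply: (pbound_pull (p := fun b => b.1.1)) bn => b [].
Qed.

Lemma pt_take : ptime D sz E (fun a => elist encX (rev (take (n a) (L a)))).
Proof. exact: (pt_rsub pt_take_aux). Qed.

Lemma pt_subn_size : ptime D sz E (fun a => enc_nat (n a - size (L a))).
Proof. exact: (pt_lsub pt_take_aux). Qed.

End TakeRules.

(** * The algorithm and its correctness *)

Section DeferredAcceptance.
Variables (T R : eqType) (cap : T -> nat).

(* An offer is addressed to a resident, who likes larger keys better. *)
Notation offer := (R * nat)%type.
Notation agent := (T * seq offer)%type.
Implicit Types (o : offer) (ag : agent) (st : seq agent) (Q p : pred offer).

Definition beats o' o : bool := (o'.1 == o.1) && (o.2 < o'.2).

(** [rev] matches the output of the truncating loop; the order of active offers is immaterial. *)
Definition active ag : seq offer := rev (take (cap ag.1) ag.2).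

Definition actives st : seq offer := flatten (map active st).

Definition all_offers st : seq offer := flatten (map snd st).

(** One predicate filters all lists, so that composed rounds are again a single [sieve] of the
    initial state. *)
Definition sieve Q st : seq agent := [seq (ag.1, [seq o <- ag.2 | Q o]) | ag <- st].

Definition unbeaten st o : bool := ~~ has (beats^~ o) (actives st).

Definition round st : seq agent := sieve (unbeaten st) st.

(** A round that changes the state deletes an offer, so this many rounds reach a fixed point. *)
Definition deferred st : seq agent := iter (size (all_offers st)) round st.

Lemma sieve_sieve p Q st : sieve p (sieve Q st) = sieve (predI p Q) st.
Proof. by rewrite /sieve -map_comp; apply: eq_map => ag /=; rewrite filter_predI. Qed.

Lemma all_offers_sieve p st : all_offers (sieve p st) = filter p (all_offers st).
Proof.
rewrite /all_offers filter_flatten; congr flatten.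
by rewrite /sieve -!map_comp; apply: eq_map.
Qed.

Lemma round_fix st : all (unbeaten st) (all_offers st) -> round st = st.
Proof.
move/allP=> h; rewrite /round /sieve -[RHS]map_id; apply/eq_in_map => -[t l] agst /=.
rewrite (all_filterP _) //; apply/allP => o ol; apply: h.
by apply/flattenP; exists l => //; apply/mapP; exists (t, l).
Qed.

Lemma round_shrinks st : round st = st \/ size (all_offers (round st)) < size (all_offers st).
Proof.
case: (boolP (all (unbeaten st) (all_offers st))) => [/round_fix|]; first by left.
by rewrite all_count => h; right; rewrite all_offers_sieve size_filter ltn_neqAle h count_size.
Qed.

Lemma deferred_fix st : round (deferred st) = deferred st.
Proof.
have iterP k : round (iter k round st) = iter k round st \/
    size (all_offers (iter k round st)) + k <= size (all_offers st).
  elim: k => [|k [IH|IH]]; first by right; rewrite addn0.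
    by left; rewrite /= !IH.
  case: (round_shrinks (iter k round st)) => [h|h]; first by left; rewrite /= !h.
  by right; rewrite /=; lia.
rewrite /deferred; case: (iterP (size (all_offers st))) => // h.
have e : all_offers (iter (size (all_offers st)) round st) = [::] by apply: size0nil; lia.
by apply: round_fix; rewrite e.
Qed.

Lemma mem_take_filter (X : eqType) n (s : seq X) (p : pred X) x :
  x \in take n s -> p x -> x \in take n (filter p s).
Proof.
elim: s n => // y s IH [|n] //=; rewrite inE => /orP[/eqP<- ->|xs px].
  by rewrite /= mem_head.
case: (p y); first by rewrite /= inE IH ?orbT.
have := IH n xs px; move: (filter p s) => s'.
by rewrite -(cat_take_drop n (take n.+1 s')) take_takel ?leqnSn // mem_cat => ->.
Qed.

(* A deleted offer is beaten by a better one, and the best active offer of a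
   resident is never deleted and stays active. *)
Lemma rejected_invariant st Q :
  (forall o, ~~ Q o -> has (beats^~ o) (actives (sieve Q st))) ->
  let Q' := predI (unbeaten (sieve Q st)) Q in
  forall o, ~~ Q' o -> has (beats^~ o) (actives (sieve Q' st)).
Proof.
move=> inv Q' o; set B := sieve Q st in inv *.
rewrite /Q' /= negb_and negbK => h.
have {h inv} : has (beats^~ o) (actives B) by case/orP: h => // /inv.
case/hasP => o1 o1A /andP[/eqP r1 k1].
have ex : exists k, (o.1, k) \in actives B.
  by exists o1.2; move: o1A; rewrite -r1 -surjective_pairing.
have bnd k : (o.1, k) \in actives B -> k <= \max_(o' <- actives B) o'.2.
  by move=> kA; apply: (@leq_bigmax_seq _ _ xpredT snd _ kA).
case: (ex_maxnP ex bnd) => k kA kmax.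
have ub : unbeaten B (o.1, k).
  apply/hasPn => o2 o2A; rewrite /beats /= negb_and -leqNgt.
  case: eqP => //= e; apply: kmax; by rewrite -e -surjective_pairing.
have Qk : Q (o.1, k).
  case/flattenP: kA => _ /mapP[_ /mapP[ag agst ->] ->].
  by rewrite /active mem_rev => /mem_take; rewrite mem_filter => /andP[].
apply/hasP; exists (o.1, k); last first.
  by rewrite /beats /= eqxx (leq_trans k1) // kmax // -r1 -surjective_pairing.
case/flattenP: kA => _ /mapP[_ /mapP[ag agst ->] ->]; rewrite /active mem_rev /= => kA.
apply/flattenP; exists (active (ag.1, [seq o <- ag.2 | Q' o])); last first.
  by rewrite /active mem_rev /= filter_predI; apply: mem_take_filter.
by apply/map_f/(map_f (fun ag => (ag.1, [seq o <- ag.2 | Q' o]))).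
Qed.

(** Interface to the correctness proof, which never looks at individual rounds: the first property
    of [Q] is an invariant of the rounds, the second expresses that the last state is a fixed
    point. *)
Lemma deferredP st : exists Q, [/\ deferred st = sieve Q st,
    forall o, ~~ Q o -> has (beats^~ o) (actives (sieve Q st))
  & forall o, o \in all_offers (sieve Q st) -> unbeaten (sieve Q st) o].
Proof.
have [Q eqQ invQ] : exists2 Q, deferred st = sieve Q st &
    forall o, ~~ Q o -> has (beats^~ o) (actives (sieve Q st)).
  rewrite /deferred; elim: (size _) => [|k [Q eqQ invQ]] /=.
    exists xpredT => //; rewrite /sieve -[LHS]map_id; apply: eq_map => -[? ?] /=.
    by rewrite filter_predT.
  exists (predI (unbeaten (sieve Q st)) Q); last exact: rejected_invariant.
  by rewrite eqQ /round sieve_sieve.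
exists Q; split=> // o; have := deferred_fix st; rewrite eqQ => fixB oB.
by move: oB; rewrite -{1}fixB all_offers_sieve mem_filter => /andP[].
Qed.

Lemma mem_take_pairwise (X : eqType) (rk : X -> nat) n (s : seq X) x :
  pairwise (fun x y => rk x < rk y) s -> x \in s ->
  x \in take n s \/ (size (take n s) = n /\ forall y, y \in take n s -> rk y < rk x).
Proof.
move=> pw xs; case: (boolP (x \in take n s)) => xt; [by left | right].
have xd : x \in drop n s by move: xs; rewrite -{1}(cat_take_drop n s) mem_cat (negbTE xt).
split.
  rewrite size_takel // leqNgt; apply/negP => lt.
  by move: xd; rewrite drop_oversize // ltnW.
move: pw; rewrite -{1}(cat_take_drop n s) pairwise_cat => /and3P[/allrelP h _ _] y yt.
exact: h.
Qed.

(** [rk] is the order in which the agent makes its offers: one that survives without being active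
    stands behind a full set of active ones. *)
Lemma offer_fate st Q rk t l o :
  (forall o, ~~ Q o -> has (beats^~ o) (actives (sieve Q st))) ->
  pairwise (fun x y => rk x < rk y) l -> o \in l ->
  let act := active (t, filter Q l) in
  [\/ o \in act, has (beats^~ o) (actives (sieve Q st))
    | size act = cap t /\ forall o', o' \in act -> rk o' < rk o].
Proof.
move=> inv pw ol act.
case: (boolP (Q o)) => [Qo|/inv]; last by constructor 2.
have of' : o \in filter Q l by rewrite mem_filter Qo.
have pwf : pairwise (fun x y => rk x < rk y) (filter Q l).
  exact: subseq_pairwise (filter_subseq _ _) pw.
case: (mem_take_pairwise (cap t) pwf of') => [h|[h1 h2]].
  by constructor 1; rewrite mem_rev.
constructor 3; rewrite size_rev h1; split=> // o'; rewrite mem_rev; exact: h2.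
Qed.

End DeferredAcceptance.

(** * Agents labelled with hospitals and quotas *)

Section Labels.
Variables H R : eqType.

(* The label of an agent: its hospital, the number of residents it must and the
   number of residents it may receive. *)
Local Notation label := (H * (nat * nat))%type.
Local Notation agent := (label * seq (R * nat))%type.

Definition label_cap (t : label) : nat := t.2.2.

(** Truncated subtraction replaces a comparison because the truncating loop already delivers this
    difference. *)
Definition satisfied (ag : agent) : bool :=
  ag.1.2.1 - size (active label_cap ag) == 0.

(** The last agent holding [r] wins. At the fixed point all agents holding [r] belong to one
    hospital, so the order does not matter. *)
Definition hospital_of (st : seq agent) (r : R) : option H :=
  foldl (fun m ag => if has (fun o => o.1 == r) (active label_cap ag)
                     then Some ag.1.1 else m) None st.

End Labels.

Arguments label_cap {H}.
Arguments satisfied {H R}.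

(** * Renaming of residents and hospitals *)

Section Embedding.
Variables (H R H' R' : eqType) (g : H -> H') (f : R -> R').
Hypotheses (f_inj : injective f).
Local Notation agent := ((H * (nat * nat)) * seq (R * nat))%type.
Implicit Types (ag : agent) (st : seq agent) (o : R * nat).

Definition embed_offer o : R' * nat := (f o.1, o.2).

Definition embed ag : (H' * (nat * nat)) * seq (R' * nat) :=
  ((g ag.1.1, ag.1.2), map embed_offer ag.2).

Lemma active_embed ag : active label_cap (embed ag) = map embed_offer (active label_cap ag).
Proof. by rewrite /active /embed /= -map_take map_rev. Qed.

Lemma actives_embed st : actives label_cap (map embed st) = map embed_offer (actives label_cap st).
Proof.
rewrite /actives map_flatten -!map_comp; congr flatten.
by apply: eq_map => ag /=; rewrite active_embed.
Qed.

Lemma round_embed st : round label_cap (map embed st) = map embed (round label_cap st).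
Proof.
rewrite /round /sieve -!map_comp; apply: eq_map => ag /=; rewrite /embed /=.
congr pair; rewrite filter_map; congr map; apply: eq_filter => o /=.
rewrite /unbeaten actives_embed has_map; congr negb; apply: eq_has => o' /=.
by rewrite /beats /= inj_eq.
Qed.

(** A round inspects names only through equality of residents, which an injective [f] preserves;
    hospitals are merely carried along in the labels. *)
Lemma deferred_embed st : deferred label_cap (map embed st) = map embed (deferred label_cap st).
Proof.
rewrite /deferred; have -> : size (all_offers (map embed st)) = size (all_offers st).
  rewrite /all_offers !size_flatten /shape -!map_comp; congr sumn.
  by apply: eq_map => ag /=; rewrite size_map.
by elim: (size _) => //= k ->; rewrite round_embed.
Qed.

Lemma satisfied_embed ag : satisfied (embed ag) = satisfied ag.
Proof. by rewrite /satisfied active_embed size_map. Qed.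

Lemma hospital_of_embed st r :
  hospital_of (map embed st) (f r) = omap g (hospital_of st r).
Proof.
elim/last_ind: st => // st ag IH; rewrite map_rcons /hospital_of !foldl_rcons.
rewrite -/(hospital_of (map embed st) (f r)) -/(hospital_of st r) IH active_embed has_map.
rewrite (eq_has (a2 := fun o => o.1 == r)); first by case: ifP.
by move=> o /=; rewrite inj_eq.
Qed.

End Embedding.

Lemma index_pairwise (X : eqType) (s : seq X) : uniq s ->
  pairwise (fun x y => index x s < index y s) s.
Proof.
case: s => // x0 s us; apply/(pairwiseP x0) => i j ii jj lt.
by rewrite !index_uniq.
Qed.

(** * Keys, levels and the agents of an instance *)

Section Algorithm.
Variable I : hrlq.
Local Notation R := (resident I).
Local Notation H := (hospital I).
Local Notation offer := (R * nat)%type.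
Implicit Types (r : R) (h : H) (o : offer).

(* Lexicographic: first the level [lv], then the preferences of [r]. *)
Definition key h r (lv : nat) : nat :=
  lv * size (rpref r) + (size (rpref r) - index h (rpref r)).

(** With d the length of the list of the resident, keys of level [lv] lie between lv * d + 1 and (lv
    + 1) * d, hence the predecessor before the division. *)
Definition level o : nat := o.2.-1 %/ size (rpref o.1).

Definition offers_at h (lvs : seq nat) : seq offer :=
  flatten [seq [seq (r, key h r lv) | r <- hpref h] | lv <- lvs].

(** Repeated simultaneous decrement stands in for binary subtraction. The length of the list of [h]
    bounds the number of steps, which is enough whenever its lower quota can be met. *)
Definition dec_pair (s : nat * nat) : nat * nat :=
  if (s.1 != 0) && (s.2 != 0) then (s.1.-1, s.2.-1) else s.

(* [(0, uquota h - lquota h)] if [lquota h <= size (hpref h)] and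
   [lquota h <= uquota h]. *)
Definition residual h : nat * nat :=
  iter (size (hpref h)) dec_pair (lquota h, uquota h).

Local Notation label := (H * (nat * nat))%type.
Local Notation agent := (label * seq offer)%type.

(** Level 0 is left to the up agents, so every low offer beats every up offer to the same
    resident. *)
Definition low_agent h : agent :=
  ((h, (lquota h, lquota h)), offers_at h (iota 1 (nres I).+1)).

Definition up_agent h : agent := ((h, residual h), offers_at h [:: 0]).

Definition agents : seq agent :=
  map low_agent (enum H) ++ map up_agent (enum H).

Definition answer : option (assignment I) :=
  let st := deferred label_cap agents in
  if all satisfied st then Some [ffun r => hospital_of st r] else None.

Lemma index_rpref h r : h \in rpref r -> index h (rpref r) < size (rpref r).
Proof. by rewrite -index_mem. Qed.

Lemma index_hpref h r : r \in hpref h -> index r (hpref h) < size (hpref h).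
Proof. by rewrite -index_mem. Qed.

Lemma key_bounds h r lv : h \in rpref r ->
  lv * size (rpref r) < key h r lv <= lv.+1 * size (rpref r).
Proof.
rewrite /key mulSn => /index_rpref lt; move: (lv * _) => x.
by apply/andP; split; lia.
Qed.

Lemma level_key h r lv : h \in rpref r -> level (r, key h r lv) = lv.
Proof.
move=> hr; have /andP[lo hi] := key_bounds lv hr; rewrite /level /=.
have d0 : 0 < size (rpref r) by case: (rpref r) hr.
have -> : (key h r lv).-1 = lv * size (rpref r) + ((key h r lv).-1 - lv * size (rpref r)) by lia.
by rewrite divnMDl // divn_small ?addn0 //; lia.
Qed.

Lemma level_mono o o' : o.1 = o'.1 -> o.2 <= o'.2 -> level o <= level o'.
Proof. by rewrite /level => -> le; apply: leq_div2r; lia. Qed.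

Lemma key_lt h h' r lv : h' \in rpref r ->
  key h r lv < key h' r lv -> index h' (rpref r) < index h (rpref r).
Proof. by rewrite /key ltn_add2l => /index_rpref; lia. Qed.

(** A key thus names its hospital: agents that hold the same offer belong to the same hospital. *)
Lemma key_inj h h' r lv lv' : h \in rpref r -> h' \in rpref r ->
  key h r lv = key h' r lv' -> h = h'.
Proof.
move=> hr hr' e.
have elv : lv = lv' by rewrite -(level_key lv hr) e level_key.
move: e; rewrite /key elv => /addnI e.
have : index h (rpref r) = index h' (rpref r).
  by move: (index_rpref hr) (index_rpref hr') e; lia.
exact: index_inj.
Qed.

Lemma offers_atP h lvs o : reflect
  (exists r lv, [/\ r \in hpref h, lv \in lvs & o = (r, key h r lv)])
  (o \in offers_at h lvs).
Proof.
apply: (iffP flatten_mapP) => [[lv lvin /mapP[r rin ->]]|[r [lv [rin lvin ->]]]].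
  by exists r, lv.
by exists lv => //; apply/mapP; exists r.
Qed.

(** The order in which an agent of [h] makes its offers, as a two-digit number: level first, then
    the preferences of [h]. *)
Definition hrank h o : nat := level o * size (hpref h) + index o.1 (hpref h).

Lemma offers_at_sorted h lvs : sorted ltn lvs ->
  pairwise (fun o o' => hrank h o < hrank h o') (offers_at h lvs).
Proof.
elim: lvs => // lv lvs IH; rewrite /= path_sortedE; last exact: ltn_trans.
case/andP=> /allP lt /IH{}IH; rewrite /offers_at /= pairwise_cat -/(offers_at h lvs) IH andbT.
apply/andP; split.
  apply/allrelP => _ o' /mapP[r rh ->] /offers_atP[r' [lv' [r'h /lt lvlt ->]]].
  rewrite /hrank !level_key ?mutual_acceptability //=.
  by move: (index_hpref rh) (index_hpref r'h) lvlt; nia.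
rewrite pairwise_map.
apply: (@sub_in_pairwise _ (mem (hpref h)) _ _ _ _ _ (index_pairwise (hpref_uniq h))); last exact/allP.
by move=> r r' rh r'h; rewrite /= /hrank !level_key ?mutual_acceptability //= ltn_add2l.
Qed.

(** * Structure of the outcome: each resident has at most one active offer *)

Section FixedPoint.
Variable Q : pred offer.
Let B := sieve Q agents.
Let sifted (ag : agent) : agent := (ag.1, [seq o <- ag.2 | Q o]).
Hypothesis rejected : forall o, ~~ Q o -> has ((beats (R := R))^~ o) (actives label_cap B).
Hypothesis stable : forall o, o \in all_offers B -> unbeaten label_cap B o.

Let low h : seq offer := active label_cap (sifted (low_agent h)).
Let up h : seq offer := active label_cap (sifted (up_agent h)).

Lemma sifted_low h : sifted (low_agent h) \in B.
Proof. by apply: (map_f sifted); rewrite mem_cat map_f ?mem_enum. Qed.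

Lemma sifted_up h : sifted (up_agent h) \in B.
Proof. by apply: (map_f sifted); rewrite mem_cat orbC map_f ?mem_enum. Qed.

Lemma siftedP ag : ag \in B ->
  exists h, ag = sifted (low_agent h) \/ ag = sifted (up_agent h).
Proof.
case/mapP=> ag0; rewrite mem_cat => /orP[] /mapP[h _ ->] ->; exists h; by [left|right].
Qed.

Lemma low_active h o : o \in low h -> o \in actives label_cap B.
Proof. by move=> oh; apply/flattenP; exists (low h) => //; apply/map_f/sifted_low. Qed.

Lemma up_active h o : o \in up h -> o \in actives label_cap B.
Proof. by move=> oh; apply/flattenP; exists (up h) => //; apply/map_f/sifted_up. Qed.

Lemma activeP o : o \in actives label_cap B -> exists h, o \in low h \/ o \in up h.
Proof.
case/flattenP=> _ /mapP[ag /siftedP[h eq_ag] ->] o_ag; exists h.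
by case: eq_ag o_ag => ->; [left | right].
Qed.

Lemma low_offer h o : o \in low h ->
  [/\ o.1 \in hpref h, 0 < level o <= (nres I).+1 & o.2 = key h o.1 (level o)].
Proof.
rewrite mem_rev => /mem_take; rewrite mem_filter => /andP[_ /offers_atP[r [lv [rh lvin ->]]]].
by rewrite level_key ?mutual_acceptability //=; split=> //; rewrite mem_iota in lvin.
Qed.

Lemma up_offer h o : o \in up h ->
  [/\ o.1 \in hpref h, level o = 0 & o.2 = key h o.1 0].
Proof.
rewrite mem_rev => /mem_take; rewrite mem_filter => /andP[_ /offers_atP[r [lv [rh lvin ->]]]].
move: lvin; rewrite inE => /eqP->.
by rewrite level_key ?mutual_acceptability.
Qed.

(** Neither of two active offers to one resident may beat the other, which forces equal keys. *)
Lemma active_inj o o' : o \in actives label_cap B -> o' \in actives label_cap B ->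
  o.1 = o'.1 -> o = o'.
Proof.
have sub x : x \in actives label_cap B -> unbeaten label_cap B x.
  case/flattenP=> _ /mapP[ag agB ->] xag; apply: stable.
  apply/flattenP; exists ag.2; first exact: map_f.
  by move: xag; rewrite mem_rev; apply: mem_take.
move=> oA o'A e; have /hasPn/(_ _ o'A) := sub _ oA; have /hasPn/(_ _ oA) := sub _ o'A.
rewrite /beats e eqxx /= -!leqNgt => le1 le2.
by case: o o' e le1 le2 {oA o'A} => [r k] [r' k'] /= -> le1 le2; congr pair; lia.
Qed.

(** The default 0 for a resident without offer is also the level of up offers, so a positive level
    means being held by a low agent. *)
Definition lvl r : nat := head 0 [seq level o | o <- actives label_cap B & o.1 == r].

Lemma lvl_active o : o \in actives label_cap B -> lvl o.1 = level o.
Proof.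
move=> oA; rewrite /lvl.
have : o \in [seq o' <- actives label_cap B | o'.1 == o.1] by rewrite mem_filter eqxx.
case E: [seq _ <- _ | _] => [|o' s] // _ /=.
have : o' \in [seq o' <- actives label_cap B | o'.1 == o.1] by rewrite E mem_head.
by rewrite mem_filter => /andP[/eqP e o'A]; rewrite (active_inj o'A oA e).
Qed.

Lemma lvl_gt0 r : 0 < lvl r -> exists h o, [/\ o \in low h, o.1 = r & level o = lvl r].
Proof.
move=> pos; have [o oA oe] : exists2 o, o \in actives label_cap B & o.1 = r.
  move: pos; rewrite /lvl; case E: [seq _ <- _ | _] => [|o s] // _.
  have : o \in [seq o' <- actives label_cap B | o'.1 == r] by rewrite E mem_head.
  by rewrite mem_filter => /andP[/eqP e oA]; exists o.
have lv := lvl_active oA; rewrite oe in lv.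
case: (activeP oA) => h [oh|/up_offer[_ l0 _]]; last by rewrite lv l0 in pos.
by exists h, o.
Qed.

Lemma beaten_lvl h r lv : h \in rpref r ->
  has ((beats (R := R))^~ (r, key h r lv)) (actives label_cap B) -> lv <= lvl r.
Proof.
move=> hr /hasP[o oA /andP[/eqP /= e lt]]; subst r.
by rewrite -(level_key lv hr) lvl_active //; apply: level_mono => //=; apply: ltnW.
Qed.

(** The first alternative covers an offer that is held as well as one that is beaten: both give [r]
    a key at least as large. *)
Lemma low_fate h r lv : r \in hpref h -> 0 < lv <= (nres I).+1 ->
  lv <= lvl r \/ (size (low h) = lquota h /\
     forall o, o \in low h -> hrank h o < hrank h (r, key h r lv)).
Proof.
move=> rh lvin; have hr : h \in rpref r by rewrite mutual_acceptability.
have oL : (r, key h r lv) \in (low_agent h).2.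
  by apply/offers_atP; exists r, lv; rewrite mem_iota.
case: (offer_fate (low_agent h).1 rejected (offers_at_sorted h (iota_ltn_sorted _ _)) oL).
- by move/low_active/lvl_active => /=; rewrite level_key // => ->; left.
- by move/(beaten_lvl hr); left.
- by right.
Qed.

(** The offer to [r] one level below [o] precedes [o] in the list of the agent. The second
    alternative of [low_fate] would put [o] before it. *)
Lemma low_level h r o : o \in low h -> r \in hpref h -> level o <= (lvl r).+1.
Proof.
move=> oh rh; have [o1h /andP[_ le] _] := low_offer oh.
have hr : h \in rpref r by rewrite mutual_acceptability.
case: (ltnP 1 (level o)) => [lt|]; last by move=> h1; apply: leq_trans h1 _.
have lvin : 0 < (level o).-1 <= (nres I).+1 by apply/andP; split; lia.
case: (low_fate rh lvin) => [|[_ /(_ _ oh)]]; first by lia.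
rewrite /hrank level_key //=; move: (index_hpref rh) => ir.
have -> : level o = (level o).-1.+1 by lia.
by rewrite mulSn /=; lia.
Qed.

(** [low_fate] at the top level n + 1, where the free place excludes the second alternative. *)
Lemma low_deficient h r : size (low h) < lquota h -> r \in hpref h ->
  nres I < lvl r.
Proof.
move=> lt rh; have lvin : 0 < (nres I).+1 <= (nres I).+1 by rewrite /= leqnn.
by case: (low_fate rh lvin) => // -[e _]; rewrite e ltnn in lt.
Qed.

Lemma size_low h : size (low h) <= lquota h.
Proof. by rewrite size_rev size_take_min geq_minl. Qed.

(** Pigeonhole: n residents cannot take all n + 1 values from 0 to n. *)
Lemma missed_level : exists2 v, v <= nres I & forall r, lvl r != v.
Proof.
case: (boolP (has (fun v => v \notin map lvl (enum R)) (iota 0 (nres I).+1))).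
  case/hasP=> v; rewrite mem_iota => lev vn; exists v; first by lia.
  by move=> r; apply: contraNneq vn => <-; rewrite map_f ?mem_enum.
move/hasPn=> h; have : {subset iota 0 (nres I).+1 <= map lvl (enum R)}.
  by move=> v /h; rewrite negbK.
move/(uniq_leq_size (iota_uniq _ _)).
by rewrite size_iota size_map -cardE card_ord ltnn.
Qed.

Lemma card_bigcup_le (T J : finType) (P : pred J) (F : J -> {set T}) :
  #|\bigcup_(j | P j) F j| <= \sum_(j | P j) #|F j|.
Proof.
elim/big_rec2: _ => [|j n X _ IH]; first by rewrite cards0.
by apply: leq_trans (leq_card_setU _ _).1 _; rewrite leq_add2l.
Qed.

(* The residents above a missed level violate Hall's condition: hospitals with a
   lower-quota place there only find residents acceptable that lie there too. *)
Lemma deficient_infeasible h0 (M : assignment I) :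
  size (low h0) < lquota h0 -> ~ feasible M.
Proof.
move=> def [accM quotaM].
have [v vn miss] := missed_level.
pose W := [set r | v < lvl r].
pose U := [set h : H | all (fun r => r \in W) (hpref h)].
have h0U : h0 \in U.
  by rewrite inE; apply/allP => r rh; rewrite inE (leq_ltn_trans vn) // (low_deficient def).
have W_low : #|W| <= \sum_(h in U) size (low h).
  have : W \subset \bigcup_(h in U) [set r in map fst (low h)].
    apply/subsetP=> r; rewrite inE => vr.
    have [h [o [oh oe lo]]] := lvl_gt0 (leq_ltn_trans (leq0n _) vr).
    apply/bigcupP; exists h; last by rewrite inE; apply/mapP; exists o.
    rewrite inE; apply/allP => r' r'h; rewrite inE.
    (* [o] has level above [v], so [r'] has level at least [v], and [v] itself is missed. *)
    have := low_level oh r'h; have := miss r'; rewrite lo; lia.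
  move/subset_leq_card => h1; apply: leq_trans h1 _; apply: leq_trans (card_bigcup_le _ _) _.
  apply: leq_sum => h _; rewrite cardsE; apply: leq_trans (card_size _) _.
  by rewrite size_map.
have low_lt : \sum_(h in U) size (low h) < \sum_(h in U) lquota h.
  rewrite (bigD1 h0) //= [X in _ < X](bigD1 h0) //= -addSn leq_add //.
  by apply: leq_sum => h _; exact: size_low.
have : \sum_(h in U) lquota h <= #|W|.
  apply: leq_trans (leq_sum _ (fun h _ => proj1 (andP (quotaM h)))) _.
  (* Double counting: after the exchange of sums each resident counts at most once, and only if her
     hospital is in [U], which puts her in [W]. *)
  have -> : \sum_(h in U) #|assigned_to M h| = \sum_(h in U) \sum_r (M r == Some h : nat).
    by apply: eq_bigr => h _; rewrite -sum1dep_card big_mkcond.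
  rewrite exchange_big /= -sum1_card [X in _ <= X]big_mkcond /=; apply: leq_sum => r _.
  case EM: (M r) => [h1|]; last by rewrite big1.
  case: (boolP (h1 \in U)) => h1U; last first.
    rewrite big1 // => h hU; case: eqP => // -[e].
    by rewrite e hU in h1U.
  rewrite (bigD1 h1) //= eqxx big1 => [|h /andP[_ ne]]; last first.
    by case: eqP => // -[e]; rewrite e eqxx in ne.
  move: h1U; rewrite inE => /allP/(_ r); rewrite -mutual_acceptability => -> //.
  exact: accM.
by move=> le; move: (leq_trans low_lt (leq_trans le W_low)); rewrite ltnn.
Qed.

Lemma uniq_offers_at h lvs : sorted ltn lvs -> uniq (offers_at h lvs).
Proof. by move/(offers_at_sorted h); apply: pairwise_uniq => o; rewrite ltnn. Qed.

(** Low and up offers differ in level, and distinct active offers go to distinct residents. This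
    lets the two sizes add up in [card_assigned]. *)
Lemma uniq_residents h : uniq (map fst (low h ++ up h)).
Proof.
rewrite map_inj_in_uniq.
  rewrite cat_uniq !rev_uniq !take_uniq ?filter_uniq ?uniq_offers_at ?iota_ltn_sorted //=.
  rewrite andbT; apply/hasPn => o /up_offer[_ l0 _]; apply/negP => /low_offer[_].
  by rewrite l0.
have act o : o \in low h ++ up h -> o \in actives label_cap B.
  by rewrite mem_cat => /orP[/low_active|/up_active].
by move=> o o' /act oh /act o'h; apply: active_inj.
Qed.

(** * The assignment read off from the outcome *)

Local Notation MB := ([ffun r => hospital_of B r] : assignment I).

Lemma hospital_of_sound (st : seq agent) r h : hospital_of st r = Some h ->
  exists2 ag, ag \in st & ag.1.1 = h /\ has (fun o => o.1 == r) (active label_cap ag).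
Proof.
elim/last_ind: st => // st ag IH; rewrite /hospital_of foldl_rcons.
case: ifP => [hs [<-]|_ /IH[ag' ag'st P]].
  by exists ag => //; rewrite mem_rcons mem_head.
by exists ag' => //; rewrite mem_rcons inE ag'st orbT.
Qed.

Lemma hospital_of_complete (st : seq agent) r ag : ag \in st ->
  has (fun o => o.1 == r) (active label_cap ag) -> hospital_of st r <> None.
Proof.
elim/last_ind: st => // st ag' IH; rewrite mem_rcons inE /hospital_of foldl_rcons.
case/orP=> [/eqP<- ->//|/IH{}IH /IH{}IH].
by case: ifP.
Qed.

Lemma hospital_active (ag : agent) o : ag \in B -> o \in active label_cap ag ->
  exists2 lv, ag.1.1 \in rpref o.1 & o.2 = key ag.1.1 o.1 lv.
Proof.
move/siftedP=> [h [->|->]] => [/low_offer|/up_offer] [oh lo ->].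
  by exists (level o) => //; rewrite mutual_acceptability.
by exists 0 => //; rewrite mutual_acceptability.
Qed.

Lemma hospital_ofP r h :
  reflect (exists2 o, o \in low h ++ up h & o.1 = r) (hospital_of B r == Some h).
Proof.
apply: (iffP eqP) => [/hospital_of_sound[ag agB [<- /hasP[o oag /eqP oe]]]|[o oh oe]].
  exists o => //; rewrite mem_cat; have [h' [e|e]] := siftedP agB; rewrite e in oag *.
    by rewrite oag.
  by rewrite oag orbT.
have [ag [agB agh oag]] : exists ag, [/\ ag \in B, ag.1.1 = h & o \in active label_cap ag].
  move: oh; rewrite mem_cat => /orP[oh|oh].
    by exists (sifted (low_agent h)); split=> //; exact: sifted_low.
  by exists (sifted (up_agent h)); split=> //; exact: sifted_up.
have hs : has (fun o => o.1 == r) (active label_cap ag).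
  by apply/hasP; exists o => //; apply/eqP.
case E: (hospital_of B r) => [h'|]; last by case: (hospital_of_complete agB hs).
have [ag' ag'B [<- /hasP[o' o'ag /eqP o'e]]] := hospital_of_sound E.
(* [r] has only one active offer, and its key names the hospital, so [ag'] and [ag] belong to the
   same one. *)
have oo' : o' = o.
  by apply: active_inj; rewrite ?o'e ?oe //; apply/flattenP;
    [exists (active label_cap ag')|exists (active label_cap ag)] => //; apply: map_f.
rewrite oo' in o'ag.
have [lv hr e1] := hospital_active agB oag; have [lv' hr' e2] := hospital_active ag'B o'ag.
by rewrite -agh; congr Some; apply: (key_inj (lv := lv') (lv' := lv) hr' hr); rewrite -e2 e1.
Qed.

Lemma card_assigned h : #|assigned_to MB h| = size (low h) + size (up h).
Proof.
rewrite -size_cat -(size_map fst) -(card_uniqP (uniq_residents h)).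
apply: eq_card => r; rewrite inE ffunE.
by apply/hospital_ofP/mapP => -[o]; [move=> ? <-|move=> ? ->]; exists o.
Qed.

Lemma iter_dec_pair k l u : iter k dec_pair (l, u) =
  (l - minn k (minn l u), u - minn k (minn l u)).
Proof.
elim: k => [|k IH]; first by rewrite min0n !subn0.
rewrite iterS IH /dec_pair /=; case: ifP => h; congr pair; lia.
Qed.

Lemma residualE h : residual h =
  (lquota h - minn (size (hpref h)) (minn (lquota h) (uquota h)),
   uquota h - minn (size (hpref h)) (minn (lquota h) (uquota h))).
Proof. exact: iter_dec_pair. Qed.

(** A feasible [M] forces [lquota h] below [uquota h] and the length of the list of [h]. Up agents
    then demand nothing, so the failing agent is a low one. *)
Lemma not_satisfied_infeasible (M : assignment I) : ~~ all satisfied B -> ~ feasible M.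
Proof.
move=> /allPn[ag /siftedP[h eq_ag] unsat] feas.
have [accM quotaM] := feas.
have ld : lquota h <= size (hpref h).
  apply: leq_trans (proj1 (andP (quotaM h))) _; rewrite cardE.
  apply: uniq_leq_size; first exact: enum_uniq.
  by move=> r; rewrite mem_enum inE -mutual_acceptability => /eqP; apply: accM.
have lu : lquota h <= uquota h by case/andP: (quotaM h); apply: leq_trans.
case: eq_ag unsat => ->; rewrite /satisfied.
  rewrite /= -/(low h) => unsat; apply: (@deficient_infeasible h M) => //.
  by rewrite -subn_gt0 lt0n.
rewrite /= residualE /= => /eqP; apply; lia.
Qed.

(** * Feasibility and blocking pairs when every agent is satisfied *)

Hypothesis sat : all satisfied B.

Lemma size_low_sat h : size (low h) = lquota h.
Proof.
have e : lquota h - size (low h) = 0 := eqP (allP sat _ (sifted_low h)).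
by have := size_low h; lia.
Qed.

(** The full low agent shows that the list of [h] is long enough. If [uquota h < lquota h], the up
    agent would then have a positive demand and capacity 0. *)
Lemma residual_sat h : lquota h <= uquota h /\ (residual h).2 = uquota h - lquota h.
Proof.
have ld : lquota h <= size (hpref h).
  rewrite -(size_low_sat h) -(size_map fst); apply: uniq_leq_size.
    by have := uniq_residents h; rewrite map_cat cat_uniq => /andP[].
  by move=> _ /mapP[o /low_offer[oh _ _] ->].
have : (residual h).1 - size (up h) = 0 := eqP (allP sat _ (sifted_up h)).
have : size (up h) <= (residual h).2 by rewrite size_rev size_take_min geq_minl.
by rewrite residualE /=; lia.
Qed.

Lemma feasible_sat : feasible MB.
Proof.
split=> [r h|h].
  rewrite ffunE => /eqP/hospital_ofP[o oh <-]; rewrite mutual_acceptability.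
  by move: oh; rewrite mem_cat => /orP[/low_offer|/up_offer] [].
rewrite card_assigned size_low_sat leq_addr andTb; have [lu e] := residual_sat h.
have : size (up h) <= (residual h).2 by rewrite size_rev size_take_min geq_minl.
by rewrite e; lia.
Qed.

Definition low_residents : {set R} := [set r | 0 < lvl r].

Lemma card_low_residents : #|low_residents| <= lquota_sum I.
Proof.
have sub : low_residents \subset \bigcup_h [set r in map fst (low h)].
  apply/subsetP=> r; rewrite inE => /lvl_gt0[h [o [oh oe _]]].
  by apply/bigcupP; exists h => //; rewrite inE; apply/mapP; exists o.
apply: leq_trans (subset_leq_card sub) _; apply: leq_trans (card_bigcup_le _ _) _.
apply: leq_sum => h _; rewrite cardsE; apply: leq_trans (card_size _) _.
by rewrite size_map size_low.
Qed.

Lemma up_fate h r : r \in hpref h ->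
  [\/ (r, key h r 0) \in up h,
      has ((beats (R := R))^~ (r, key h r 0)) (actives label_cap B)
    | size (up h) = (residual h).2 /\
      forall o, o \in up h -> index o.1 (hpref h) < index r (hpref h)].
Proof.
move=> rh; have hr : h \in rpref r by rewrite mutual_acceptability.
have oL : (r, key h r 0) \in (up_agent h).2.
  by apply/offers_atP; exists r, 0; rewrite mem_head.
have srt : sorted ltn [:: 0] by [].
case: (offer_fate (up_agent h).1 rejected (offers_at_sorted h srt) oL) => [?|?|[e lt]].
- by constructor 1.
- by constructor 2.
- constructor 3; split=> // o oh; have := lt _ oh.
  by have [_ l0 _] := up_offer oh; rewrite /hrank l0 level_key.
Qed.

Lemma blocking_low r h : blocking MB r h -> r \in low_residents.
Proof.
case/and4P=> hr rh pref block; rewrite inE lt0n; apply/negP => /eqP l0.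
(* Any hospital holding [r] is strictly worse for her than [h]. *)
have assigned o h' : o \in low h' ++ up h' -> o.1 = r ->
    ~~ (index h' (rpref r) <= index h (rpref r)).
  move=> oh' oe; have /eqP e : hospital_of B r == Some h' by apply/hospital_ofP; exists o.
  by move: pref; rewrite ffunE e /prefers -ltnNge.
case: (up_fate rh) => [ru|/hasP[o oA /andP[/eqP /= oe lt]]|[full before]].
- by have := assigned (r, key h r 0) h; rewrite mem_cat ru orbT leqnn => /(_ isT erefl).
(* As [r] has level 0, the beating offer is an up offer, and a larger key at the same level means a
   better hospital. *)
- have [h' [/low_offer[_ /andP[pos _] _]|oh']] := activeP oA.
    by move: pos; rewrite -lvl_active // oe l0.
  have := assigned o h'; rewrite mem_cat oh' orbT => /(_ isT oe)/negP; apply.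
  have [o1h' _ ok] := up_offer oh'; rewrite ok oe in lt; rewrite oe in o1h'.
  by apply/ltnW/(key_lt _ lt); rewrite mutual_acceptability.
(* Both agents of [h] are full, which adds up to [uquota h]; so [h] would have to prefer [r] to some
   [r'] that it holds. *)
have [lu e] := residual_sat h.
move: block; rewrite /under_subscribed card_assigned size_low_sat full e subnKC // ltnn /=.
case/existsP=> r'; rewrite inE ffunE => /andP[/hospital_ofP[o oh <-]].
rewrite /prefers ltnNge => /negP; apply; apply: ltnW.
move: oh; rewrite mem_cat => /orP[oh|/before //].
(* Since [lvl r = 0], low offers of [h] have level at most 1, and within level 1 [hrank] compares by
   the list of [h] alone. *)
have lv1 : level o = 1.
  have := low_level oh rh; rewrite l0; have [_ /andP[pos _] _] := low_offer oh; lia.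
have := @low_fate h r 1 rh isT; rewrite l0 => -[//|[_ /(_ _ oh)]].
by rewrite /hrank lv1 level_key // ltn_add2l.
Qed.

Lemma card_blocking : #|blocking_pairs MB| <= (Delta_R I - 1) * lquota_sum I.
Proof.
pose F r : {set R * H} := [set (r, h) | h in [set h : H | (h \in rpref r) && (MB r != Some h)]].
have sub : blocking_pairs MB \subset \bigcup_(r in low_residents) F r.
  apply/subsetP=> -[r h]; rewrite inE => bl; apply/bigcupP; exists r.
    exact: blocking_low bl.
  case/and4P: bl => /= hr _ pref _; apply/imsetP; exists h => //; rewrite inE hr /=.
  by apply/eqP => e; move: pref; rewrite e /prefers ltnn.
apply: leq_trans (subset_leq_card sub) _; apply: leq_trans (card_bigcup_le _ _) _.
apply: (@leq_trans (\sum_(r in low_residents) (Delta_R I - 1))).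
  apply: leq_sum => r; rewrite inE => /lvl_gt0[h [o [oh oe _]]].
  have Mr : hospital_of B r = Some h.
    by apply/eqP/hospital_ofP; exists o; rewrite ?mem_cat ?oh.
  have hr : h \in rpref r.
    by have [o1 _ _] := low_offer oh; rewrite mutual_acceptability -oe.
  apply: (@leq_trans (size (rpref r) - 1)); last first.
    by apply: leq_sub2r; apply: (@leq_bigmax _ (fun r : R => size (rpref r))).
  apply: leq_trans (leq_imset_card _ _) _; rewrite cardE.
  (* The hospital of [r] is on her list but not in a blocking pair with her: this is the origin of
     the [- 1]. *)
  apply: (@leq_trans (size (rem h (rpref r)))); last by rewrite size_rem // subn1.
  apply: uniq_leq_size; first exact: enum_uniq.
  move=> h'; rewrite mem_enum inE ffunE Mr => /andP[h'r ne].
  rewrite mem_rem_uniq ?rpref_uniq // inE h'r andbT.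
  by apply: contraNneq ne => ->.
by rewrite sum_nat_const mulnC leq_mul2l card_low_residents orbT.
Qed.

End FixedPoint.

Lemma answerP :
  match answer with
  | Some M =>
      [/\ feasible M, #|blocking_pairs M| <= (Delta_R I - 1) * lquota_sum I
        & exists S : {set resident I}, #|S| <= lquota_sum I /\
            forall (r : resident I) (h : hospital I), blocking M r h -> r \in S]
  | None => forall M : assignment I, ~ feasible M
  end.
Proof.
rewrite /answer; have [Q [-> rej stab]] := deferredP label_cap agents.
case: ifP => [sat|/negbT unsat]; last first.
  by move=> M; exact: (not_satisfied_infeasible rej stab unsat).
split; [exact: (feasible_sat stab sat)|exact: (card_blocking rej stab sat)|].
exists (low_residents Q); split; first exact: (card_low_residents stab).
by move=> r h; exact: (blocking_low rej stab sat).
Qed.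

End Algorithm.

(** * The algorithm runs in polynomial time *)

(* The rules for lists need element types that do not depend on the input, so the
   program is described on instances whose agents are named by numbers. *)
Definition raw_resident := (nat * seq nat)%type.
Definition raw_hospital := (nat * (nat * (nat * seq nat)))%type.
Definition raw_instance := (seq raw_resident * seq raw_hospital)%type.

Definition enc_names_nat : seq nat -> tree := elist enc_nat.

Definition enc_raw_resident (x : raw_resident) : tree :=
  Node (enc_nat x.1) (enc_names_nat x.2).

Definition enc_raw_hospital (x : raw_hospital) : tree :=
  Node (enc_nat x.1) (Node (enc_nat x.2.1) (Node (enc_nat x.2.2.1) (enc_names_nat x.2.2.2))).

Definition enc_offer (o : nat * nat) : tree := Node (enc_nat o.1) (un o.2).

Definition raw_agent := ((nat * (nat * nat)) * seq (nat * nat))%type.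

Definition enc_label (t : nat * (nat * nat)) : tree :=
  Node (enc_nat t.1) (Node (enc_nat t.2.1) (enc_nat t.2.2)).

Definition enc_agent (ag : raw_agent) : tree :=
  Node (enc_label ag.1) (elist enc_offer ag.2).

Definition lookup (rt : seq raw_resident) (r : nat) : seq nat :=
  foldr (fun x s => if x.1 == r then x.2 else s) [::] rt.

Definition raw_key (l : seq nat) (h lv : nat) : nat :=
  lv * size l + (size l - index h l).

Definition raw_offers (rt : seq raw_resident) (h : nat) (hp : seq nat) (lvs : seq nat) :=
  flatten [seq [seq (r, raw_key (lookup rt r) h lv) | r <- hp] | lv <- lvs].

Definition raw_low (rt : seq raw_resident) (x : raw_hospital) : raw_agent :=
  ((x.1, (x.2.1, x.2.1)), raw_offers rt x.1 x.2.2.2 (iota 1 (size rt).+1)).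

Definition raw_up (rt : seq raw_resident) (x : raw_hospital) : raw_agent :=
  ((x.1, iter (size x.2.2.2) dec_pair (x.2.1, x.2.2.1)),
   raw_offers rt x.1 x.2.2.2 [:: 0]).

Definition raw_agents (a : raw_instance) : seq raw_agent :=
  map (raw_low a.1) a.2 ++ map (raw_up a.1) a.2.

Definition raw_answer (a : raw_instance) : option (seq (option nat)) :=
  let st := deferred label_cap (raw_agents a) in
  if all satisfied st then Some [seq hospital_of st x.1 | x <- a.1] else None.

Ltac lift H := apply: pt_weak; apply: (pt_pull (p := fst)) H => // ? [] //.
Ltac blift H := apply: (pbound_pull (p := fst)) H => // ? [] //.

Lemma lookup_mem rt r :
  lookup rt r = [::] \/ exists2 x : raw_resident, x \in rt & lookup rt r = x.2.
Proof.
elim: rt => [|x rt IH] /=; first by left.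
case: ifP => _; first by right; exists x; rewrite ?mem_head.
by case: IH => [|[y yin e]]; [left|right; exists y; rewrite // inE yin orbT].
Qed.

(** * Computation of the keys and the initial agents *)

Section Pieces.
Variables (A : Type) (D : A -> Prop) (sz : A -> nat) (E : A -> seq tree).

Lemma pt_lookup (rt : A -> seq raw_resident) (r : A -> nat) :
  ptime D sz E (fun a => elist enc_raw_resident (rt a)) ->
  ptime D sz E (fun a => enc_nat (r a)) ->
  pbound D sz (fun a => size (rt a)) ->
  pbound (ranging D rt) (fun b => sz b.1) (fun b => size (nat_bits b.2.1)) ->
  ptime D sz E (fun a => enc_names_nat (lookup (rt a) (r a))).
Proof.
move=> hrt hr brt bx.
apply: (@pt_foldr _ _ _ _ _ _ _ _ _ (fun=> [::])
  (fun a x s => if x.1 == r a then x.2 else s) (fun _ _ => True)) => //; try eassumption.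
  exact: pt_leaf.
apply: (@pt_ext _ _ _ _ (fun b => if b.1.2.1 == r b.1.1 then enc_names_nat b.1.2.2
  else enc_names_nat b.2)); first by move=> b _; case: ifP.
apply: pt_ifT; [|exact: (pt_rsub (pt_var _ _ _ 0))|exact: (pt_var _ _ _ 1)].
apply: pt_eqn; first exact: (pt_lsub (pt_var _ _ _ 0)).
  by apply: pt_weak2; apply: (pt_pull (p := fun b => b.1.1)) hr => // b [].
by apply: (pbound_pull (p := fun b => (b.1.1, b.1.2))) bx => b [].
Qed.

Lemma pbound_lookup (rt : A -> seq raw_resident) (r : A -> nat) :
  pbound (ranging D rt) (fun b => sz b.1) (fun b => size b.2.2) ->
  pbound D sz (fun a => size (lookup (rt a) (r a))).
Proof.
case=> c bc; exists c => a Da; case: (lookup_mem (rt a) (r a)) => [->|[x xin ->]] //.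
exact: (bc (a, x)).
Qed.

(** The difference is the length of the suffix of the list that starts at [h], so one pass that
    counts from the first match computes it. *)
Lemma pt_suffix_size (l : A -> seq nat) (h : A -> nat) :
  ptime D sz E (fun a => enc_names_nat (l a)) -> ptime D sz E (fun a => enc_nat (h a)) ->
  pbound D sz (fun a => size (l a)) -> pbound D sz (nbits h) ->
  ptime D sz E (fun a => un (size (l a) - index (h a) (l a))).
Proof.
move=> hl hh bl bh.
pose step (h : nat) (k x : nat) := if (0 < k) || (h == x) then k.+1 else 0.
have stepS h0 k s : 0 < k -> foldl (step h0) k s = k + size s.
  elim: s k => [|x s IH] k k0 /=; first by rewrite addn0.
  by rewrite {2}/step k0 /= IH // addSnnS.
apply: (@pt_ext _ _ _ _ (fun a => un (foldl (step (h a)) 0 (l a)))).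
  move=> a _; congr un; elim: (l a) => //= x s IH.
  rewrite {2}/step /= [x == _]eq_sym; case: ifP => // _.
  by rewrite stepS // add1n subn0.
apply: (@pt_foldl _ _ _ _ _ _ _ _ _ (fun=> 0) (fun a => step (h a)) (fun _ _ => True)) => //;
  try eassumption; first exact: pt_leaf.
apply: (@pt_ext _ _ _ _ (fun b => if (0 < b.2) || (h b.1.1 == b.1.2) then Node Leaf (un b.2)
  else Leaf)); first by move=> b _; rewrite /step; case: ifP.
apply: pt_ifT; [|exact: pt_node (pt_leaf _ _ _) (pt_var _ _ _ 1)|exact: pt_leaf].
apply: pt_orb.
  by apply: pt_ext (pt_is_node (pt_var _ _ _ 1)) => b _; rewrite /= is_node_un.
apply: pt_eqn; last by apply: (pbound_pull (p := fun b => b.1.1)) bh => b [].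
  by apply: pt_weak2; apply: (pt_pull (p := fun b => b.1.1)) hh => // b [].
exact: (pt_var _ _ _ 0).
Qed.

Lemma pt_key (l : A -> seq nat) (h lv : A -> nat) :
  ptime D sz E (fun a => enc_names_nat (l a)) -> ptime D sz E (fun a => enc_nat (h a)) ->
  ptime D sz E (fun a => un (lv a)) ->
  pbound D sz (fun a => size (l a)) -> pbound D sz (nbits h) -> pbound D sz lv ->
  ptime D sz E (fun a => un (raw_key (l a) (h a) (lv a))).
Proof.
move=> hl hh hlv bl bh blv; apply: pt_un_add; last exact: pbound_mul.
  by apply: pt_un_mul => //; apply: pt_size hl bl.
exact: pt_suffix_size.
Qed.

End Pieces.

Lemma pt_raw_offers (A : Type) (D : A -> Prop) sz E
    (rt : A -> seq raw_resident) (h : A -> nat) (hp lvs : A -> seq nat) :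
  ptime D sz E (fun a => elist enc_raw_resident (rt a)) ->
  ptime D sz E (fun a => enc_nat (h a)) ->
  ptime D sz E (fun a => enc_names_nat (hp a)) ->
  ptime D sz E (fun a => elist un (lvs a)) ->
  pbound D sz (fun a => size (rt a)) ->
  pbound (ranging D rt) (fun b => sz b.1) (fun b => size (nat_bits b.2.1)) ->
  pbound (ranging D rt) (fun b => sz b.1) (fun b => size b.2.2) ->
  pbound D sz (nbits h) -> pbound D sz (fun a => size (hp a)) ->
  pbound D sz (fun a => size (lvs a)) ->
  pbound (ranging D lvs) (fun b => sz b.1) (fun b => b.2) ->
  ptime D sz E (fun a => elist enc_offer (raw_offers (rt a) (h a) (hp a) (lvs a))).
Proof.
move=> hrt hh hhp hlvs brt brn brs bh bhp blvs blv.
apply: pt_flatten; first last.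
- apply: (@pbound_le _ _ _ _ (fun b => size (hp b.1))); last by blift bhp.
  by move=> [a l] [_ /= /mapP[lv _ ->]]; rewrite size_map.
- by apply: pbound_le blvs => a _; rewrite size_map.
apply: pt_map; [exact: hlvs|exact: blvs|].
apply: pt_map; [by lift hhp|by blift bhp|].
apply: pt_node; first exact: (pt_var _ _ _ 0).
have dom (b : A * nat * nat) : ranging (ranging D lvs) (fun b => hp b.1) b -> D b.1.1.
  by case=> [[]].
have dom2 (b : A * nat * nat * raw_resident) :
    ranging (ranging (ranging D lvs) (fun b => hp b.1)) (fun b => rt b.1.1) b ->
    ranging D rt (b.1.1.1, b.2) by case=> [[[]]].
apply: pt_key.
- apply: pt_lookup.
  + by apply: pt_weak2; apply: (pt_pull (p := fun b => b.1.1)) hrt.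
  + exact: (pt_var _ _ _ 0).
  + exact: (pbound_pull (p := fun b => b.1.1)) brt.
  + exact: (pbound_pull (p := fun b => (b.1.1.1, b.2))) brn.
- by apply: pt_weak2; apply: (pt_pull (p := fun b => b.1.1)) hh.
- exact: (pt_var _ _ _ 1).
- apply: pbound_lookup.
  exact: (pbound_pull (p := fun b => (b.1.1.1, b.2))) brs.
- exact: (pbound_pull (p := fun b => b.1.1)) bh.
- by apply: (pbound_pull (p := fun b => b.1)) blv => b [].
Qed.

(** The levels are consed in increasing order, each as successor of the current head, and reversed
    at the end. *)
Lemma pt_levels (A : Type) (D : A -> Prop) sz E (X : eqType) (encX : X -> tree) (l : A -> seq X) :
  ptime D sz E (fun a => elist encX (l a)) -> pbound D sz (fun a => size (l a)) ->
  ptime D sz E (fun a => elist un (iota 1 (size (l a)).+1)).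
Proof.
move=> hl bl; pose desc (s : seq X) := foldr (fun _ s => (head 0 s).+1 :: s) [:: 1] s.
have revI k : rev (iota 1 k.+1) = k.+1 :: rev (iota 1 k).
  by rewrite -[in LHS](addn1 k) iotaD rev_cat /= add1n.
have descE s : desc s = rev (iota 1 (size s).+1).
  by elim: s => // x s IH; rewrite [size _]/= revI [LHS]/= -/(desc s) IH revI.
apply: (@pt_ext _ _ _ _ (fun a => elist un (rev (desc (l a))))).
  by move=> a _; rewrite descE revK.
apply: pt_rev; last first.
  apply: (@pbound_le _ _ _ _ (fun a => size (l a) + 1)).
    by move=> a _; rewrite descE size_rev size_iota addn1.
  by apply: pbound_add => //; exact: pbound_const.
apply: (@pt_foldr _ _ _ _ _ _ _ _ _ (fun=> [:: 1]) (fun _ _ s => (head 0 s).+1 :: s)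
  (fun _ _ => True)) => //; try eassumption.
  exact: pt_node (pt_node (pt_leaf _ _ _) (pt_leaf _ _ _)) (pt_leaf _ _ _).
apply: pt_node; last exact: (pt_var _ _ _ 1).
apply: pt_node; first exact: pt_leaf.
by apply: pt_ext (pt_lsub (pt_var _ _ _ 1)) => -[[a x] [|k s]].
Qed.

Lemma size_nat_bits_dec_pair l u : let s := dec_pair (l, u) in
  size (nat_bits s.1) <= size (nat_bits l) /\ size (nat_bits s.2) <= size (nat_bits u).
Proof. by rewrite /dec_pair /=; case: ifP => _ /=; rewrite ?size_nat_bits_pred. Qed.

Lemma size_nat_bits_residual k l u : let s := iter k dec_pair (l, u) in
  size (nat_bits s.1) <= size (nat_bits l) /\ size (nat_bits s.2) <= size (nat_bits u).
Proof.
elim: k => //= k [IH1 IH2]; case: (iter _ _ _) IH1 IH2 => l' u' /= IH1 IH2.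
have [] := size_nat_bits_dec_pair l' u'.
by move=> h1 h2; split; [apply: leq_trans h1 _ | apply: leq_trans h2 _].
Qed.

Lemma pt_residual (A : Type) (D : A -> Prop) sz E (hp : A -> seq nat) (l u : A -> nat) :
  ptime D sz E (fun a => enc_names_nat (hp a)) ->
  ptime D sz E (fun a => enc_nat (l a)) -> ptime D sz E (fun a => enc_nat (u a)) ->
  pbound D sz (fun a => size (hp a)) -> pbound D sz (nbits l) -> pbound D sz (nbits u) ->
  ptime D sz E (fun a => let s := iter (size (hp a)) dec_pair (l a, u a) in
    Node (enc_nat s.1) (enc_nat s.2)).
Proof.
move=> hhp hl hu bhp bl bu.
pose enc2 (s : nat * nat) := Node (enc_nat s.1) (enc_nat s.2).
pose Inv (a : A) (s : nat * nat) :=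
  size (nat_bits s.1) <= nbits l a /\ size (nat_bits s.2) <= nbits u a.
apply: (@pt_un_iter _ _ _ _ _ enc2 _ (fun a => (l a, u a)) (fun=> dec_pair) Inv) => //.
- exact: pt_size hhp bhp.
- exact: pt_node.
- move=> a [l' u'] _ [/= IH1 IH2]; have [h1 h2] := size_nat_bits_dec_pair l' u'.
  by split; [apply: leq_trans h1 _ | apply: leq_trans h2 _].
apply: (@pt_ext _ _ _ _ (fun b => if (b.2.1 != 0) && (b.2.2 != 0) then
  Node (enc_nat b.2.1.-1) (enc_nat b.2.2.-1) else enc2 b.2)).
  by move=> b _; rewrite /dec_pair; case: ifP.
set D' := fun b : A * (nat * nat) => _; set E' := fun b : A * (nat * nat) => _ :: _.
have h1 : ptime D' (fun b => sz b.1) E' (fun b => enc_nat b.2.1) := pt_lsub (pt_var _ _ _ 0).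
have h2 : ptime D' (fun b => sz b.1) E' (fun b => enc_nat b.2.2) := pt_rsub (pt_var _ _ _ 0).
apply: pt_ifT; last exact: (pt_var _ _ _ 0).
  by apply: pt_andb; apply: pt_neq0.
apply: pt_node; apply: pt_pred => //.
  apply: (@pbound_le _ _ _ _ (fun b => nbits l b.1)); first by move=> b [_ []].
  by blift bl.
apply: (@pbound_le _ _ _ _ (fun b => nbits u b.1)); first by move=> b [_ []].
by blift bu.
Qed.


(** * Uniform size bounds along the run *)

Definition good_offer (K : nat) (o : nat * nat) : bool :=
  (size (nat_bits o.1) <= K) && (o.2 <= K).

Definition good_agent (K : nat) (ag : raw_agent) : bool :=
  [&& size (nat_bits ag.1.2.1) <= K, size (nat_bits ag.1.2.2) <= K,
      size ag.2 <= K & all (good_offer K) ag.2].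

(** Binary numbers are bounded by length and unary keys by value. Rounds only delete offers, so one
    [K] fixed by the input serves as loop invariant. *)
Definition good_state (K : nat) (st : seq raw_agent) : bool :=
  (size st <= K) && all (good_agent K) st.

Lemma size_flatten_le (X : eqType) (ll : seq (seq X)) k :
  (forall l, l \in ll -> size l <= k) -> size (flatten ll) <= size ll * k.
Proof.
elim: ll => //= l ll IH h; rewrite size_cat mulSn leq_add ?h ?mem_head //.
by apply: IH => l' l'in; apply: h; rewrite inE l'in orbT.
Qed.

Lemma good_active K ag : good_agent K ag ->
  size (active label_cap ag) <= K /\
  forall o, o \in active label_cap ag -> good_offer K o.
Proof.
case/and4P=> _ _ le /allP h; split.
  rewrite size_rev; apply: leq_trans le.
  by rewrite -{2}(cat_take_drop (label_cap ag.1) ag.2) size_cat leq_addr.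
by move=> o; rewrite mem_rev => /mem_take/h.
Qed.

Lemma good_actives K st : good_state K st ->
  size (actives label_cap st) <= K * K /\
  forall o, o \in actives label_cap st -> good_offer K o.
Proof.
case/andP=> le /allP h; split.
  apply: leq_trans (size_flatten_le (k := K) _) _.
    by move=> _ /mapP[ag /h/good_active[] ? _ ->].
  by rewrite size_map leq_mul2r le orbT.
by move=> o /flattenP[_ /mapP[ag /h/good_active[_ hag] ->]]; apply: hag.
Qed.

Lemma good_round K st : good_state K st -> good_state K (round label_cap st).
Proof.
case/andP=> le /allP h; rewrite /good_state size_map le /=.
apply/allP => _ /mapP[ag /h/and4P[h1 h2 h3 /allP h4] ->].
rewrite /good_agent /= h1 h2 (leq_trans _ h3) ?size_filter ?count_size //=.
by apply/allP => o; rewrite mem_filter => /andP[_ /h4].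
Qed.

Section DeferredTime.
Variables (A : Type) (D : A -> Prop) (sz : A -> nat) (E : A -> seq tree) (K : A -> nat).
Hypothesis bK : pbound D sz K.

Lemma pt_active (ag : A -> raw_agent) : (forall a, D a -> good_agent (K a) (ag a)) ->
  ptime D sz E (fun a => enc_agent (ag a)) ->
  ptime D sz E (fun a => elist enc_offer (active label_cap (ag a))).
Proof.
move=> good hag; apply: pt_take.
- exact: (pt_rsub (pt_rsub (pt_lsub hag))).
- by apply: pbound_le bK => a /good/and4P[].
- exact: (pt_rsub hag).
- by apply: pbound_le bK => a /good/and4P[].
Qed.

End DeferredTime.

Lemma pt_actives (A : Type) (D : A -> Prop) (sz : A -> nat) E K (st : A -> seq raw_agent) :
  pbound D sz K -> (forall a, D a -> good_state (K a) (st a)) ->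
  ptime D sz E (fun a => elist enc_agent (st a)) ->
  ptime D sz E (fun a => elist enc_offer (actives label_cap (st a))).
Proof.
move=> bK good hst; apply: pt_flatten; first last.
- apply: (@pbound_le _ _ _ _ (fun b => K b.1)); last by blift bK.
  by move=> [a l] /= [/good/andP[_ /allP h] /= /mapP[ag /h/good_active[] ? _ ->]].
- by apply: pbound_le bK => a /good/andP[]; rewrite size_map.
apply: pt_map; [exact: hst|by apply: pbound_le bK => a /good/andP[]|].
apply: (@pt_active _ _ _ _ (fun b => K b.1)); first by blift bK.
  by move=> [a ag] /= [/good/andP[_ /allP h] /= /h].
exact: (pt_var _ _ _ 0).
Qed.

Lemma pt_round (A : Type) (D : A -> Prop) (sz : A -> nat) E K (st : A -> seq raw_agent) :
  pbound D sz K -> (forall a, D a -> good_state (K a) (st a)) ->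
  ptime D sz E (fun a => elist enc_agent (st a)) ->
  ptime D sz E (fun a => elist enc_agent (round label_cap (st a))).
Proof.
(* The active offers are computed once per round; the test of a single offer finds them as variable
   2 of its context. *)
move=> bK good hst; apply: (pt_let (pt_actives bK good hst)).
apply: pt_map; [exact: pt_weak hst|by apply: pbound_le bK => a /good/andP[]|].
apply: pt_node; first exact: (pt_lsub (pt_var _ _ _ 0)).
apply: pt_filter.
- exact: (pt_rsub (pt_var _ _ _ 0)).
- apply: (@pbound_le _ _ _ _ (fun b => K b.1)); last by blift bK.
  by move=> [a ag] [/good/andP[_ /allP h] /= /h/and4P[]].
apply: pt_negb; apply: pt_has.
- exact: (pt_var _ _ _ 2).
- apply: (@pbound_le _ _ _ _ (fun b => K b.1.1 * K b.1.1)).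
    by move=> [[a ag] o] [[/good/good_actives[]]].
  by apply: pbound_mul; apply: (pbound_pull (p := fun b => b.1.1)) bK => b [[]].
apply: pt_andb.
  apply: pt_eqn; [exact: (pt_lsub (pt_var _ _ _ 0))|exact: (pt_lsub (pt_var _ _ _ 1))|].
  apply: (@pbound_le _ _ _ _ (fun b => K b.1.1.1)).
    by move=> [[[a ag] o] o'] [[[/good/good_actives[_ h] _] _] /= /h/andP[]].
  by apply: (pbound_pull (p := fun b => b.1.1.1)) bK => b [[[]]].
apply: pt_un_lt; [exact: (pt_rsub (pt_var _ _ _ 1))|exact: (pt_rsub (pt_var _ _ _ 0))|].
apply: (@pbound_le _ _ _ _ (fun b => K b.1.1.1)).
  move=> [[[a ag] o] o'] [[[/good/andP[_ /allP h] /= /h/and4P[_ _ _ /allP h4]] /= /h4]].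
  by case/andP.
by apply: (pbound_pull (p := fun b => b.1.1.1)) bK => b [[[]]].
Qed.

Lemma pt_deferred (A : Type) (D : A -> Prop) (sz : A -> nat) E K (st : A -> seq raw_agent) :
  pbound D sz K -> (forall a, D a -> good_state (K a) (st a)) ->
  ptime D sz E (fun a => elist enc_agent (st a)) ->
  ptime D sz E (fun a => elist enc_agent (deferred label_cap (st a))).
Proof.
move=> bK good hst.
have bst : pbound D sz (fun a => size (st a)) by apply: pbound_le bK => a /good/andP[].
have bn : pbound D sz (fun a => size (all_offers (st a))).
  apply: (@pbound_le _ _ _ _ (fun a => K a * K a)); last exact: pbound_mul.
  move=> a /good/andP[le /allP h]; apply: leq_trans (size_flatten_le (k := K a) _) _.
    by move=> _ /mapP[ag /h/and4P[_ _ ? _] ->].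
  by rewrite size_map leq_mul2r le orbT.
apply: (@pt_un_iter _ _ _ _ _ (elist enc_agent) _ _ (fun=> round label_cap)
  (fun a s => good_state (K a) s)) => //.
- apply: pt_size; last exact: bn.
  apply: pt_flatten; first last.
  + apply: (@pbound_le _ _ _ _ (fun b => K b.1)); last by blift bK.
    by move=> [a l] /= [/good/andP[_ /allP h] /= /mapP[ag /h/and4P[_ _ ? _] ->]].
  + by apply: pbound_le bst => a _; rewrite size_map.
  apply: (pt_map (f := fun=> snd)); [exact: hst|exact: bst|exact: (pt_rsub (pt_var _ _ _ 0))].
- by move=> a s _; apply: good_round.
apply: (@pt_round _ _ _ _ (fun b => K b.1)); first by blift bK.
  by move=> b [].
exact: (pt_var _ _ _ 0).
Qed.

Lemma pt_all_satisfied (A : Type) (D : A -> Prop) (sz : A -> nat) E K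
    (st : A -> seq raw_agent) :
  pbound D sz K -> (forall a, D a -> good_state (K a) (st a)) ->
  ptime D sz E (fun a => elist enc_agent (st a)) ->
  ptime D sz E (fun a => enc_bit (all satisfied (st a))).
Proof.
move=> bK good hst.
have gag (b : A * raw_agent) : ranging D st b -> good_agent (K b.1) b.2.
  by case: b => a ag [/good/andP[_ /allP h] /= /h].
have bK1 : pbound (ranging D st) (fun b => sz b.1) (fun b => K b.1) by blift bK.
apply: (pt_all (p := fun=> satisfied)); [exact: hst| |].
  by apply: pbound_le bK => a /good/andP[].
apply: (@pt_ext _ _ _ _ (fun b => enc_bit (~~ (b.2.1.2.1 - size (active label_cap b.2) != 0)))).
  by move=> b _; rewrite negbK.
apply/pt_negb/pt_neq0; apply: pt_subn_size.
- exact: (pt_lsub (pt_rsub (pt_lsub (pt_var _ _ _ 0)))).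
- by apply: pbound_le bK1 => b /gag/and4P[].
- apply: (pt_active bK1) => //; exact: (pt_var _ _ _ 0).
- by apply: pbound_le bK1 => b /gag/good_active[].
Qed.

Lemma pt_hospital_of (A : Type) (D : A -> Prop) (sz : A -> nat) E K
    (st : A -> seq raw_agent) (r : A -> nat) :
  pbound D sz K -> (forall a, D a -> good_state (K a) (st a)) ->
  ptime D sz E (fun a => elist enc_agent (st a)) ->
  ptime D sz E (fun a => enc_nat (r a)) ->
  ptime D sz E (fun a => enc_option enc_nat (hospital_of (st a) (r a))).
Proof.
move=> bK good hst hr.
apply: (@pt_foldl _ _ _ _ _ _ enc_agent (enc_option enc_nat) _ (fun=> None)
  (fun a m ag => if has (fun o => o.1 == r a) (active label_cap ag)
     then Some ag.1.1 else m) (fun _ _ => True)) => //.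
- exact: pt_leaf.
- by apply: pbound_le bK => a /good/andP[].
set D' := fun b : A * raw_agent * option nat => _.
have dom b : D' b -> D b.1.1 by case.
have gag b : D' b -> good_agent (K b.1.1) b.1.2.
  by case: b => [[a ag] m] [/good/andP[_ /allP h] /= /h].
have bK1 : pbound D' (fun b => sz b.1.1) (fun b => K b.1.1).
  exact: (pbound_pull (p := fun b => b.1.1)) bK.
apply: (@pt_ext _ _ _ _ (fun b => if has (fun o => o.1 == r b.1.1) (active label_cap b.1.2)
   then Node Leaf (enc_nat b.1.2.1.1) else enc_option enc_nat b.2)).
  by move=> b _; case: ifP.
apply: pt_ifT; last exact: (pt_var _ _ _ 1).
  apply: pt_has.
  - apply: (pt_active bK1) => //; exact: (pt_var _ _ _ 0).
  - by apply: pbound_le bK1 => b /gag/good_active[].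
  apply: pt_eqn; first exact: (pt_lsub (pt_var _ _ _ 0)).
    apply: pt_weak; apply: pt_weak2.
    by apply: (pt_pull (p := fun b => b.1.1.1)) hr => // b [/dom].
  apply: (@pbound_le _ _ _ _ (fun b => K b.1.1.1)); last by blift bK1.
  by move=> [b o] [/gag/good_active[_ h] /= /h/andP[]].
exact: pt_node (pt_leaf _ _ _) (pt_lsub (pt_lsub (pt_var _ _ _ 0))).
Qed.

(** * Bounds by the size of the encoded instance *)

Lemma tree_size_elist_mem (X : eqType) (enc : X -> tree) x l :
  x \in l -> tree_size (enc x) <= tree_size (elist enc l).
Proof.
elim: l => //= y l IH; rewrite inE => /orP[/eqP->|/IH{}IH]; first by lia.
by apply: leq_trans IH _; rewrite /elist; lia.
Qed.

Lemma size_elist (X : Type) (enc : X -> tree) l : size l <= tree_size (elist enc l).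
Proof. by elim: l => //= x l; rewrite /elist; lia. Qed.

Lemma size_nat_bits_enc n : size (nat_bits n) <= tree_size (enc_nat n).
Proof. exact: (size_elist enc_bit). Qed.

Definition raw_size (a : raw_instance) : nat :=
  tree_size (Node (elist enc_raw_resident a.1) (elist enc_raw_hospital a.2)).

Lemma raw_resident_size (a : raw_instance) (x : raw_resident) : x \in a.1 ->
  size (nat_bits x.1) <= raw_size a /\ size x.2 <= raw_size a.
Proof.
move=> xa; have hx : tree_size (enc_raw_resident x) <= tree_size (elist enc_raw_resident a.1).
  exact: tree_size_elist_mem.
have := size_nat_bits_enc x.1; have := size_elist enc_nat x.2; move: hx.
by rewrite /raw_size /= /enc_names_nat; lia.
Qed.

Lemma raw_hospital_size (a : raw_instance) (x : raw_hospital) : x \in a.2 ->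
  [/\ size (nat_bits x.1) <= raw_size a, size (nat_bits x.2.1) <= raw_size a,
      size (nat_bits x.2.2.1) <= raw_size a, size x.2.2.2 <= raw_size a
    & forall r, r \in x.2.2.2 -> size (nat_bits r) <= raw_size a].
Proof.
move=> xa; have hx : tree_size (enc_raw_hospital x) <= tree_size (elist enc_raw_hospital a.2).
  exact: tree_size_elist_mem.
have := size_nat_bits_enc x.1; have := size_elist enc_nat x.2.2.2.
have := size_nat_bits_enc x.2.1; have := size_nat_bits_enc x.2.2.1; move: hx.
rewrite /raw_size /= /enc_names_nat => h1 h2 h3 h4 h5; split; try lia.
move=> r rx; have hr : tree_size (enc_nat r) <= tree_size (elist enc_nat x.2.2.2).
  exact: tree_size_elist_mem.
by have := size_nat_bits_enc r; lia.
Qed.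

Lemma raw_sizes (a : raw_instance) : size a.1 <= raw_size a /\ size a.2 <= raw_size a.
Proof.
have := size_elist enc_raw_resident a.1; have := size_elist enc_raw_hospital a.2.
by rewrite /raw_size /=; lia.
Qed.

(** With N the input size, there are at most 2N agents with at most (N + 1)N offers each, and keys
    are at most (N + 2)N; the cube dominates all of these. *)
Definition state_bound (a : raw_instance) : nat := (raw_size a).+2 ^ 3.

Lemma good_raw_offers (a : raw_instance) (x : raw_hospital) (lvs : seq nat) : x \in a.2 -> size lvs <= (raw_size a).+1 ->
  (forall lv, lv \in lvs -> lv <= (raw_size a).+1) ->
  let l := raw_offers a.1 x.1 x.2.2.2 lvs in
  size l <= state_bound a /\ all (good_offer (state_bound a)) l.
Proof.
move=> xa les lel; have [_ _ _ hp hr] := raw_hospital_size xa.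
have N3 : state_bound a = (raw_size a).+2 * ((raw_size a).+2 * (raw_size a).+2).
  by rewrite /state_bound !expnS expn0 muln1.
rewrite N3; split.
  apply: leq_trans (size_flatten_le (k := raw_size a) _) _.
    by move=> _ /mapP[lv _ ->]; rewrite size_map.
  by rewrite size_map; nia.
apply/allP => _ /flatten_mapP[lv /lel lvle /mapP[r /hr rle ->]].
rewrite /good_offer /=; apply/andP; split; first by nia.
have szl : size (lookup a.1 r) <= raw_size a.
  by case: (lookup_mem a.1 r) => [->|[y /raw_resident_size[_ h] ->]].
rewrite /raw_key; move: (index _ _) => i; move: (size _) szl => d; nia.
Qed.

Lemma good_raw_agents a : good_state (state_bound a) (raw_agents a).
Proof.
have [le1 le2] := raw_sizes a.
have N3 : raw_size a + raw_size a <= state_bound a.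
  by rewrite /state_bound !expnS expn0; nia.
rewrite /good_state size_cat !size_map; apply/andP; split; first by lia.
rewrite all_cat; apply/andP; split; apply/allP => _ /mapP[x xa ->].
  have [_ h1 _ _ _] := raw_hospital_size xa.
  have [|lv|h2 h3] := @good_raw_offers a x (iota 1 (size a.1).+1) xa.
  - by rewrite size_iota.
  - by rewrite mem_iota; lia.
  by rewrite /good_agent /= -/(iota 1 (size a.1).+1) h2 h3 andbT; lia.
have [_ h1 h1' _ _] := raw_hospital_size xa.
have [|lv|h2 h3] := @good_raw_offers a x [:: 0] xa => //.
  by rewrite inE => /eqP->.
rewrite /good_agent [_.2]/= h2 h3.
have [] := size_nat_bits_residual (size x.2.2.2) x.2.1 x.2.2.1 => /=; lia.
Qed.

Lemma good_deferred K st : good_state K st -> good_state K (deferred label_cap st).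
Proof. by rewrite /deferred => h; elim: (size _) => //= k; apply: good_round. Qed.

Definition enc_raw_answer (o : option (seq (option nat))) : tree :=
  enc_option (elist (enc_option enc_nat)) o.

(** The odd context is the input itself: a [Node] of two encoded lists reads as one list with the
    first as head. [pt_comp] then regroups it into two variables. *)
Lemma pt_raw_answer : ptime (fun=> True) raw_size
  (fun a => elist enc_raw_resident a.1 :: map enc_raw_hospital a.2)
  (fun a => enc_raw_answer (raw_answer a)).
Proof.
have [psz brt] : pbound (fun=> True) raw_size raw_size /\
    pbound (fun=> True) raw_size (fun a => size a.1).
  by split; [exact: pbound_sz|apply: pbound_le (pbound_sz _ _) => a _; case: (raw_sizes a)].
have bht : pbound (fun=> True) raw_size (fun a => size a.2).
  by apply: pbound_le psz => a _; case: (raw_sizes a).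
have bK : pbound (fun=> True) raw_size state_bound by exists 3.
apply: (@pt_comp _ _ _ _ (fun a =>
  [:: elist enc_raw_resident a.1; elist enc_raw_hospital a.2])).
  apply: pt_node; first exact: (pt_var _ _ _ 0).
  apply: pt_node; last exact: pt_leaf.
  by apply: pt_ext (pt_drop _ _ _ 1) => a _ /=; rewrite drop0.
apply: (@pt_let _ _ _ _ (fun a => elist un (iota 1 (size a.1).+1))).
  by apply: (@pt_levels _ _ _ _ _ enc_raw_resident) => //; exact: (pt_var _ _ _ 0).
have hag : ptime (fun=> True) raw_size (fun a => [:: elist un (iota 1 (size a.1).+1);
    elist enc_raw_resident a.1; elist enc_raw_hospital a.2])
    (fun a => elist enc_agent (raw_agents a)).
  set D' := ranging (fun=> True) (fun a : raw_instance => a.2).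
  have bsz : pbound D' (fun b => raw_size b.1) (fun b => raw_size b.1) by blift psz.
  have bnd : [/\ pbound D' (fun b => raw_size b.1) (nbits (fun b => b.2.1)),
      pbound D' (fun b => raw_size b.1) (nbits (fun b => b.2.2.1)),
      pbound D' (fun b => raw_size b.1) (nbits (fun b => b.2.2.2.1)) &
      pbound D' (fun b => raw_size b.1) (fun b => size b.2.2.2.2)].
    by split; apply: pbound_le bsz => b [_ /raw_hospital_size[]].
  case: bnd => bh bl bu bhp.
  have brt' : pbound D' (fun b => raw_size b.1) (fun b => size b.1.1) by blift brt.
  have brn : pbound (ranging D' (fun b => b.1.1)) (fun b => raw_size b.1.1)
      (fun b => size (nat_bits b.2.1)).
    apply: (@pbound_le _ _ _ _ (fun b => raw_size b.1.1)); last by blift bsz.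
    by move=> b [_ /raw_resident_size[]].
  have brs : pbound (ranging D' (fun b => b.1.1)) (fun b => raw_size b.1.1)
      (fun b => size b.2.2).
    apply: (@pbound_le _ _ _ _ (fun b => raw_size b.1.1)); last by blift bsz.
    by move=> b [_ /raw_resident_size[]].
  apply: pt_cat; last by apply: pbound_le bht => a _; rewrite size_map.
  - apply: pt_map; [exact: (pt_var _ _ _ 2)|exact: bht|].
    apply: pt_node.
      apply: pt_node; first exact: (pt_lsub (pt_var _ _ _ 0)).
      by apply: pt_node; exact: (pt_lsub (pt_rsub (pt_var _ _ _ 0))).
    apply: pt_raw_offers => //.
    + exact: (pt_var _ _ _ 2).
    + exact: (pt_lsub (pt_var _ _ _ 0)).
    + exact: (pt_rsub (pt_rsub (pt_rsub (pt_var _ _ _ 0)))).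
    + exact: (pt_var _ _ _ 1).
    + apply: (@pbound_le _ _ _ _ (fun b => size b.1.1 + 1)).
        by move=> b _; rewrite size_iota addn1.
      by apply: pbound_add => //; exact: pbound_const.
    + apply: (@pbound_le _ _ _ _ (fun b => size b.1.1.1 + 1)).
        by move=> b [_]; rewrite mem_iota add1n ltnS addn1 => /andP[].
      by apply: pbound_add; [blift brt'|exact: pbound_const].
  - apply: pt_map; [exact: (pt_var _ _ _ 2)|exact: bht|].
    apply: pt_node.
      apply: pt_node; first exact: (pt_lsub (pt_var _ _ _ 0)).
      apply: pt_residual => //.
      + exact: (pt_rsub (pt_rsub (pt_rsub (pt_var _ _ _ 0)))).
      + exact: (pt_lsub (pt_rsub (pt_var _ _ _ 0))).
      + exact: (pt_lsub (pt_rsub (pt_rsub (pt_var _ _ _ 0)))).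
    apply: pt_raw_offers => //.
    + exact: (pt_var _ _ _ 2).
    + exact: (pt_lsub (pt_var _ _ _ 0)).
    + exact: (pt_rsub (pt_rsub (pt_rsub (pt_var _ _ _ 0)))).
    + exact: pt_node (pt_leaf _ _ _) (pt_leaf _ _ _).
    + exact: pbound_const.
    + apply: pbound_le (pbound_const _ _ 0) => b [_].
      by rewrite inE => /eqP->.
have good a : good_state (state_bound a) (deferred label_cap (raw_agents a)).
  exact/good_deferred/good_raw_agents.
apply: (pt_let (pt_deferred bK (fun a _ => good_raw_agents a) hag)).
apply: (@pt_ext _ _ _ _ (fun a => if all satisfied (deferred label_cap (raw_agents a))
  then Node Leaf (elist (enc_option enc_nat)
    [seq hospital_of (deferred label_cap (raw_agents a)) x.1 | x <- a.1]) else Leaf)).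
  by move=> a _; rewrite /raw_answer; case: ifP.
apply: pt_ifT; last exact: pt_leaf.
  apply: (pt_all_satisfied bK) => //; exact: (pt_var _ _ _ 0).
apply: pt_node; first exact: pt_leaf.
apply: pt_map; [exact: (pt_var _ _ _ 2)|exact: brt|].
apply: (@pt_hospital_of _ _ _ _ (fun b => state_bound b.1)) => //.
- by blift bK.
- exact: (pt_var _ _ _ 1).
- exact: (pt_lsub (pt_var _ _ _ 0)).
Qed.

(** * From numbered names back to instances *)

Section Raw.
Variable I : hrlq.

Definition raw_resident_of (r : resident I) : raw_resident :=
  (val r, map val (rpref r)).

Definition raw_hospital_of (h : hospital I) : raw_hospital :=
  (val h, (lquota h, (uquota h, map val (hpref h)))).

Definition raw_of : raw_instance :=
  (map raw_resident_of (enum (resident I)), map raw_hospital_of (enum (hospital I))).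

Lemma enc_raw_of : enc_instance I =
  enc_list (elist enc_raw_resident raw_of.1 :: map enc_raw_hospital raw_of.2).
Proof.
rewrite /enc_instance /elist /= -!map_comp; congr Node.
  congr enc_list; apply: eq_map => r; rewrite /enc_resident /enc_raw_resident /=.
  by rewrite /enc_names_nat /elist -map_comp.
congr enc_list; apply: eq_map => h; rewrite /enc_hospital /enc_raw_hospital /=.
by rewrite /enc_names_nat /elist -map_comp.
Qed.

Lemma lookup_raw_of (r : resident I) : lookup raw_of.1 (val r) = map val (rpref r).
Proof.
rewrite /raw_of /=; have : r \in enum (resident I) by rewrite mem_enum.
elim: (enum _) => //= x s IH; rewrite inE => /orP[/eqP<-|/IH{}IH].
  by rewrite eqxx.
by case: ifP => // /eqP/val_inj ->.
Qed.

Lemma raw_offers_of (h : hospital I) lvs :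
  raw_offers raw_of.1 (val h) (map val (hpref h)) lvs =
  map (embed_offer val) (offers_at h lvs).
Proof.
move: raw_of.1 lookup_raw_of => rt rtE.
rewrite /raw_offers /offers_at map_flatten -map_comp; congr flatten.
apply: eq_map => lv /=; rewrite -!map_comp; apply: eq_map => r /=.
rewrite /embed_offer /= rtE /raw_key /key size_map index_map //.
exact: val_inj.
Qed.

Lemma raw_agents_of : raw_agents raw_of = map (embed val val) (agents I).
Proof.
rewrite /raw_agents /agents map_cat -!map_comp; congr cat.
  apply: eq_map => h; rewrite /raw_low /embed /=; congr pair.
  rewrite -raw_offers_of size_map -cardE card_ord //.
apply: eq_map => h; rewrite /raw_up /embed /= -raw_offers_of size_map //.
Qed.

(** The two runs agree up to the injective renaming [val], and ordinals are encoded by their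
    values. *)
Lemma raw_answer_of : enc_raw_answer (raw_answer raw_of) = enc_answer (answer I).
Proof.
rewrite /raw_answer /answer raw_agents_of deferred_embed; last exact: val_inj.
rewrite all_map (eq_all (a2 := satisfied)); last first.
  by move=> ag /=; rewrite satisfied_embed.
case: ifP => // _; rewrite /enc_raw_answer /= /enc_assignment /elist.
rewrite -!map_comp; congr (Node _ (enc_list _)); apply: eq_map => r /=.
rewrite hospital_of_embed; last exact: val_inj.
by rewrite ffunE; case: hospital_of.
Qed.

End Raw.

Theorem theorem3 :
  polytime_solvable enc_instance enc_answer
    (fun (I : hrlq) (answer : option (assignment I)) =>
       match answer with
       | Some M =>
           [/\ feasible M,
               #|blocking_pairs M| <= (Delta_R I - 1) * lquota_sum I
             & exists S : {set resident I},
                 #|S| <= lquota_sum I /\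
                 forall (r : resident I) (h : hospital I),
                   blocking M r h -> r \in S]
       | None => forall M : assignment I, ~ feasible M
       end).
Proof.
have [P [e [cl cb [T [c bT] ev]]]] := pt_raw_answer.
(* Execution starts at function 0, so [e] goes in front and all calls move up by 1. The polynomial
   is the bound of [pbound], as [raw_size] is the size of the encoding. *)
exists (shift 1 e :: map (shift 1) P), (('X + 2%:P) ^+ c)%R => I.
have [t evt le] := ev (raw_of I) Logic.I.
exists (answer I), t; split; last exact: answerP.
- rewrite -raw_answer_of enc_raw_of /run /body [nth _ _ _]/=.
  by apply: (eval_shift cl _ evt cb) => f ltf; rewrite /body /= (nth_map ELeaf).
- rewrite horner_exp hornerD hornerX hornerC.
  apply: leq_trans le _; apply: leq_trans (bT _ Logic.I) _.
  by rewrite /raw_size enc_raw_of !natrE addn2.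
Qed.
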